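(* Let $T>0$ be a fixed horizon, $\rho_T>0$, and suppose the nominal distribution $\mathbb{P}_T^\circ$ of the disturbance vector $\boldsymbol{\xi}_T$ is Gaussian. Let $\Pi_T$ be the class of (possibly nonlinear) causal estimators $\pi_T=(\pi_0,\dots,\pi_{T-1})$, where $\widehat{s}_t=\pi_t(y_t,y_{t-1},\dots,y_0)$, and write $\mathbf{e}_T(\boldsymbol{\xi}_T,\pi_T)=\widehat{\mathbf{s}}_T-\mathbf{s}_T$. Then $$\inf_{\pi_T\in\Pi_T}\ \sup_{\mathbb{P}_T\in\mathcal{W}_T(\mathbb{P}_T^\circ,\rho_T)}\mathbb{E}_{\mathbb{P}_T}\big[\|\mathbf{e}_T(\boldsymbol{\xi}_T,\pi_T)\|^2\big]=\sup_{\mathbb{P}_T\in\mathcal{W}_T(\mathbb{P}_T^\circ,\rho_T)}\ \inf_{\pi_T\in\Pi_T}\mathbb{E}_{\mathbb{P}_T}\big[\|\mathbf{e}_T(\boldsymbol{\xi}_T,\pi_T)\|^2\big].$$ Moreover, this problem admits a saddle point $(\pi_T^\star,\mathbb{P}_T^\star)$ such that $\mathbb{P}_T^\star$ is Gaussian and $\pi_T^\star$ is linear, i.e. $\widehat{\mathbf{s}}_T=\mathcal{K}_T^\star\mathbf{y}_T$ for some block lower-triangular matrix $\mathcal{K}_T^\star\in\mathbb{R}^{Td_s\times Td_y}$.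
   Context: State-space model: $x_{t+1}=Ax_t+Bw_t$, $y_t=C_yx_t+v_t$, $s_t=C_sx_t$, with $x_t\in\mathbb{R}^{d_x}$, $w_t\in\mathbb{R}^{d_w}$, $v_t\in\mathbb{R}^{d_v}$ ($d_v=d_y$), $y_t\in\mathbb{R}^{d_y}$, $s_t\in\mathbb{R}^{d_s}$; $(A,C_y)$ and $(A,C_s)$ detectable and $(A,B)$ controllable. For horizon $T$: $\mathbf{y}_T=[y_0;\dots;y_{T-1}]$, $\mathbf{s}_T=[s_0;\dots;s_{T-1}]$, $\mathbf{w}_T=[x_0;w_0;\dots;w_{T-2}]$ (the unknown initial state is part of the process noise), $\mathbf{v}_T=[v_0;\dots;v_{T-1}]$, and $\boldsymbol{\xi}_T=[\mathbf{w}_T;\mathbf{v}_T]\in\Xi_T=\mathbb{R}^{d_x+(T-1)d_w+Td_v}$. Then $\mathbf{y}_T=\mathcal{H}_T\mathbf{w}_T+\mathbf{v}_T$, $\mathbf{s}_T=\mathcal{L}_T\mathbf{w}_T$ with block lower-triangular $\mathcal{H}_T,\mathcal{L}_T$ determined by the model (the $t$-th block of $\mathcal{H}_T\mathbf{w}_T$ is $C_yA^tx_0+\sum_{\tau=0}^{t-1}C_yA^{t-1-\tau}Bw_\tau$, and similarly for $\mathcal{L}_T$ with $C_s$). The disturbance distributions are zero-mean (standing assumption). The Wasserstein-2 distance between distributions on $\mathbb{R}^n$ with finite second moments is $\mathsf{W}_2(\mathbb{P}_1,\mathbb{P}_2)=(\inf\mathbb{E}\|\mathbf{w}_1-\mathbf{w}_2\|^2)^{1/2}$,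 the infimum over couplings with marginals $\mathbb{P}_1,\mathbb{P}_2$. The ambiguity set is $\mathcal{W}_T(\mathbb{P}_T^\circ,\rho_T)=\{\mathbb{P}_T\text{ on }\Xi_T\text{ with finite second moment}:\mathsf{W}_2(\mathbb{P}_T,\mathbb{P}_T^\circ)\le\rho_T\}$, and $\boldsymbol{\xi}_T\sim\mathbb{P}_T$ in the expectations. *)

(* Defs.v *)
From HB Require Import structures.
From mathcomp Require Import all_boot all_order all_algebra.
From mathcomp Require Import all_classical all_reals all_analysis.
Set Implicit Arguments. Unset Strict Implicit. Unset Printing Implicit Defensive.
Import Order.TTheory GRing.Theory Num.Theory numFieldTopology.Exports numFieldNormedType.Exports.
Local Open Scope classical_set_scope.
Local Open Scope ring_scope.

(* Borel sigma-algebra on column vectors R^n: generated by the coordinate    *)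
(* projections (= product of the Borel sigma-algebras of R = Borel(R^n)).    *)
Definition vec_display : measure_display -> measure_display. Proof. exact. Qed.

Section vec_meas.
Context {R : realType} (n : nat).
Let coor : 'I_n -> 'cV[R]_n -> R := fun i v => v i 0.
Let s0 : g_sigma_preimage coor set0.
Proof. exact: sigma_algebra0. Qed.
Let sC A : g_sigma_preimage coor A -> g_sigma_preimage coor (~` A).
Proof. by move=> h; rewrite -setTD; exact: sigma_algebraCD. Qed.
Let sU (F : _^nat) : (forall i, g_sigma_preimage coor (F i)) ->
  g_sigma_preimage coor (\bigcup_i (F i)).
Proof. exact: sigma_algebra_bigcup. Qed.
HB.instance Definition _ :=
  @isMeasurable.Build (vec_display default_measure_display)
  'cV[R]_n (g_sigma_preimage coor) s0 sC sU.
End vec_meas.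

Definition sqnorm {R : realType} {n : nat} (v : 'cV[R]_n) : R :=
  \sum_(i < n) v i 0 ^+ 2.

(* t-th block (t < k) of u; zero if t >= k *)
Definition blk {R : realType} (k d : nat) (u : 'cV[R]_(k * d)) (t : nat)
  : 'cV[R]_d :=
  \col_(j < d) (match (insub (t * d + j)%N : option 'I_(k * d)) with
                | Some i => u i 0 | None => 0 end).

Lemma stk_proof (k d : nat) (i : 'I_(k * d)) : (i %% d < d)%N.
Proof.
case: d i => [|d] i; last by rewrite ltn_mod.
by move: (nat_of_ord i) (ltn_ord i) => m; rewrite muln0.
Qed.

Definition stk {R : realType} (k d : nat) (f : nat -> 'cV[R]_d) : 'cV[R]_(k * d) :=
  \col_(i < k * d) f (i %/ d)%N (Ordinal (stk_proof i)) 0.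
Arguments stk {R} k d f.

(*   xi = [w; v],  w = [x0; w_0; ...; w_{T-2}],  v = [v_0; ...; v_{T-1}]     *)
Definition xidim (dx dw dy T : nat) : nat := (dx + T.-1 * dw + T * dy)%N.

Definition Xi (R : realType) (dx dw dy T : nat) := 'cV[R]_(dx + T.-1 * dw + T * dy).

Section model.
Context {R : realType} {dx dw dy ds T : nat}.
Variables (A : 'M[R]_dx) (B : 'M[R]_(dx, dw)) (Cy : 'M[R]_(dy, dx))
  (Cs : 'M[R]_(ds, dx)).

Definition wpart (xi : 'cV[R]_(dx + T.-1 * dw + T * dy)) : 'cV[R]_(dx + T.-1 * dw) :=
  usubmx xi.
Definition vpart (xi : 'cV[R]_(dx + T.-1 * dw + T * dy)) : 'cV[R]_(T * dy) :=
  dsubmx xi.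
Definition x0_of (xi : 'cV[R]_(dx + T.-1 * dw + T * dy)) : 'cV[R]_dx :=
  usubmx (wpart xi).
Definition w_of (xi : 'cV[R]_(dx + T.-1 * dw + T * dy)) (t : nat) : 'cV[R]_dw :=
  blk (dsubmx (wpart xi)) t.
Definition v_of (xi : 'cV[R]_(dx + T.-1 * dw + T * dy)) (t : nat) : 'cV[R]_dy :=
  blk (vpart xi) t.

Fixpoint x_of (xi : 'cV[R]_(dx + T.-1 * dw + T * dy)) (t : nat) : 'cV[R]_dx :=
  match t with
  | 0 => x0_of xi
  | t'.+1 => A *m x_of xi t' + B *m w_of xi t'
  end.

Definition y_of xi t : 'cV[R]_dy := Cy *m x_of xi t + v_of xi t.
Definition s_of xi t : 'cV[R]_ds := Cs *m x_of xi t.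

Definition yvec xi : 'cV[R]_(T * dy) := stk T dy (y_of xi).
Definition svec xi : 'cV[R]_(T * ds) := stk T ds (s_of xi).

Definition err (pi : 'cV[R]_(T * dy) -> 'cV[R]_(T * ds)) xi : 'cV[R]_(T * ds) :=
  pi (yvec xi) - svec xi.

Definition cost (pi : 'cV[R]_(T * dy) -> 'cV[R]_(T * ds))
    (P : probability 'cV[R]_(dx + T.-1 * dw + T * dy) R) : \bar R :=
  (\int[P]_xi (sqnorm (err pi xi))%:E)%E.

End model.

Definition causal {R : realType} {dy ds T : nat}
    (pi : 'cV[R]_(T * dy) -> 'cV[R]_(T * ds)) : Prop :=
  forall t : nat, (t < T)%N -> forall y y' : 'cV[R]_(T * dy),
    (forall tau : nat, (tau <= t)%N -> blk y tau = blk y' tau) ->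
    blk (pi y) t = blk (pi y') t.

Definition estimators {R : realType} (dy ds T : nat)
  : set ('cV[R]_(T * dy) -> 'cV[R]_(T * ds)) :=
  [set pi | measurable_fun setT pi /\ causal pi].
Arguments estimators {R} dy ds T.

Definition block_lower {R : realType} {dy ds T : nat}
    (K : 'M[R]_(T * ds, T * dy)) : Prop :=
  forall (i : 'I_(T * ds)) (j : 'I_(T * dy)), (i %/ ds < j %/ dy)%N -> K i j = 0.

Definition second_moment_finite {R : realType} {n : nat}
    (P : probability 'cV[R]_n R) : Prop :=
  (\int[P]_x (sqnorm x)%:E < +oo)%E.

Definition coupling {R : realType} {n : nat}
    (P1 P2 : probability 'cV[R]_n R)
    (g : probability ('cV[R]_n * 'cV[R]_n)%type R) : Prop :=
  forall S : set 'cV[R]_n, measurable S ->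
    g (S `*` setT) = P1 S /\ g (setT `*` S) = P2 S.

Definition W2sq {R : realType} {n : nat} (P1 P2 : probability 'cV[R]_n R)
  : \bar R :=
  ereal_inf [set (\int[g]_z (sqnorm (z.1 - z.2))%:E)%E
            | g in [set g | coupling P1 P2 g]].

Definition W2 {R : realType} {n : nat} (P1 P2 : probability 'cV[R]_n R)
  : \bar R :=
  match W2sq P1 P2 with
  | r%:E => (Num.sqrt r)%:E
  | +oo%E => +oo%E
  | -oo%E => -oo%E
  end.

Definition ambiguity {R : realType} {n : nat} (P0 : probability 'cV[R]_n R)
    (rho : R) : set (probability 'cV[R]_n R) :=
  [set P | second_moment_finite P /\ (W2 P P0 <= rho%:E)%E].

Definition normal1 {R : realType} (m v : R) : set R -> \bar R :=
  if v == 0 then (fun S => \d_m S) else normal_prob m (Num.sqrt v).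

Definition lin_fun {R : realType} {n : nat} (a : 'cV[R]_n) (x : 'cV[R]_n) : R :=
  (a^T *m x) 0 0.

Definition gaussian_with_mean {R : realType} {n : nat}
    (mu : 'cV[R]_n) (P : probability 'cV[R]_n R) : Prop :=
  exists Sigma : 'M[R]_n,
    (forall a : 'cV[R]_n, 0 <= (a^T *m Sigma *m a) 0 0) /\
    forall a : 'cV[R]_n, forall S : set R, measurable S ->
      P (lin_fun a @^-1` S) = normal1 (lin_fun a mu) ((a^T *m Sigma *m a) 0 0) S.

Definition gaussian {R : realType} {n : nat} (P : probability 'cV[R]_n R) : Prop :=
  exists mu : 'cV[R]_n, gaussian_with_mean mu P.

(* (A, C) detectable: there is an output-injection gain L with A - L C Schur *)
Definition detectable {R : realType} {nx ny : nat} (A : 'M[R]_nx)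
    (C : 'M[R]_(ny, nx)) : Prop :=
  exists L : 'M[R]_(nx, ny), forall i j : 'I_nx,
    (fun k : nat => ((A - L *m C) ^+ k) i j) @ \oo --> (0 : R).

Definition controllable {R : realType} {nx nu : nat} (A : 'M[R]_nx)
    (B : 'M[R]_(nx, nu)) : Prop :=
  \rank (\mxrow_(k < nx) (A ^+ k *m B)) = nx.

(* Main.v *)
Require Import Defs.
From HB Require Import structures.
From mathcomp Require Import all_boot all_order all_algebra.
From mathcomp Require Import all_classical all_reals all_analysis.
From mathcomp Require Import measurable_realfun ring lra.
Import Order.TTheory GRing.Theory Num.Theory numFieldTopology.Exports numFieldNormedType.Exports.
Local Open Scope classical_set_scope.
Local Open Scope ring_scope.
Set Implicit Arguments.
Unset Strict Implicit.
Unset Printing Implicit Defensive.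

(* A causal linear estimator has mean square error [qf (K H - L) S], where [S] is
   the second-moment matrix of the disturbance and [y = H xi], [s = L xi]; this is
   convex in [K] and linear in [S]. The matrices [S] reachable within the Wasserstein
   ball form a compact convex set, the projection of a spectrahedron of second-moment
   matrices of couplings, so a saddle point [(K, S)] exists. A Gaussian law with
   second-moment matrix [S] is obtained inside the ball as the law of
   [T xi0 + noise], with [xi0] nominal and independent Gaussian noise. For that law,
   optimality of [K] among causal gains makes each error coordinate uncorrelated with
   the observations available at its time, hence independent of them, and then no
   nonlinear causal estimator does better than [K]. *)

(** * Quadratic-linear minimax *)

(** Three obstacles shape the argument. The cost can be flat in the gain when [H S H^T] is singular,
    so its minimizers need not be unique or bounded. A quadratic penalty restores uniqueness and is
    then sent to zero; the gains stay bounded because [rho > 0] puts [S0 + d%:M], with some [d > 0],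
    in the reachable set, and because the measurement noise gives [H] an identity block. Next, the
    infimum defining the Wasserstein distance is not assumed attained: a law in the ball is only
    known to have couplings of cost below [rho ^+ 2 + eps], and their second-moment matrices are
    mixed with that of the identity coupling. Finally, [gaussian] prescribes only one-dimensional
    projections, so vector laws are compared through characteristic functions, and Gaussian laws
    with possibly singular matrices are built by adding one scalar normal variable at a time instead
    of by a density. Compactness is used through one fixed free ultrafilter on [nat], along which
    all bounded sequences converge simultaneously. *)

Lemma cvg_sum {R : realType} {T : Type} (F : set_system T) {FF : Filter F} (I : Type)
    (r : seq I) (f : T -> I -> R) (l : I -> R) :
  (forall i, f k i @[k --> F] --> l i) ->
  \sum_(i <- r) f k i @[k --> F] --> \sum_(i <- r) l i.
Proof.
move=> h; elim: r => [|i r IH].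
  by rewrite big_nil; under eq_fun do rewrite big_nil; exact: cvg_cst.
by rewrite big_cons; under eq_fun do rewrite big_cons; exact: cvgD.
Qed.

(** The image of an ultrafilter is an ultrafilter on the compact segment [[-M, M]], hence converges.
    This replaces the extraction of subsequences. *)
Lemma bounded_ultra_cvg {R : realType} (U : set_system nat) (u : nat -> R) (M : R) :
  UltraFilter U -> (forall k, `|u k| <= M) -> exists l : R, u k @[k --> U] --> l.
Proof.
move=> UU uM.
have UF : UltraFilter (u k @[k --> U]).
  split=> [|G GF sUG]; first exact: fmap_proper_filter.
  apply/seteqP; split => // A GA.
  have [//|UnA] := in_ultra_setVsetC (u @^-1` A) UU.
  have GnA : G (~` A) by exact: sUG.
  have G0 : G set0 by rewrite -(setICr A); exact: filterI.
  by case: (@filter_not_empty _ G _ G0).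
have := @segment_compact R (- M) M.
rewrite compact_ultra /= => cpt.
have [] := cpt _ UF; last by move=> l [_ ul]; exists l.
suff : U (u @^-1` `[- M, M]) by [].
by apply: filterS filterT => k _ /=; rewrite in_itv /= -ler_norml.
Qed.

Lemma free_ultrafilter : exists U : set_system nat, UltraFilter U /\ \oo `<=` U.
Proof. exact: ultraFilterLemma. Qed.

Section ultralimit.
Context {R : realType} (U : set_system nat) {UU : UltraFilter U} (ooU : \oo `<=` U).

Lemma oo_ultra_cvg (u : nat -> R) (l : R) : u @ \oo --> l -> u k @[k --> U] --> l.
Proof. by move=> ul A /ul; exact: ooU. Qed.

Lemma ultra_harmonic : k.+1%:R^-1 @[k --> U] --> (0 : R).
Proof. by apply: oo_ultra_cvg; exact: cvg_harmonic. Qed.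

Lemma ultra_ler (u v : nat -> R) (l m : R) :
  u k @[k --> U] --> l -> v k @[k --> U] --> m -> (forall k, u k <= v k) -> l <= m.
Proof. by move=> ul vm uv; apply: (ler_cvg_to ul vm); exact: nearW. Qed.

(** Turns sequential compactness into a uniform bound: a sequence whose [k]-th value exceeds [k]
    cannot converge along a free ultrafilter. *)
Lemma ultra_cvg_lt_nat (u : nat -> R) (l : R) :
  u k @[k --> U] --> l -> exists k, u k < k%:R.
Proof.
move=> ul.
have U1 : U [set k | u k < l + 1].
  by apply: (cvgr_lt l ul); rewrite ltrDl.
have U2 : U [set k | l + 1 <= k%:R].
  by apply: ooU; exact: nbhs_infty_ger.
have /filter_ex [k [/= h1 h2]] :
    U ([set k | u k < l + 1] `&` [set k | l + 1 <= k%:R]) by exact: filterI.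
by exists k; exact: lt_le_trans h2.
Qed.

Definition mxcvg {p q : nat} (Z : nat -> 'M[R]_(p, q)) (L : 'M[R]_(p, q)) :=
  forall i j, Z k i j @[k --> U] --> L i j.

Lemma mxcvg_bounded (p q : nat) (Z : nat -> 'M[R]_(p, q)) (M : R) :
  (forall k i j, `|Z k i j| <= M) -> exists L, mxcvg Z L.
Proof.
move=> ZM.
have h (ij : 'I_p * 'I_q) : exists l : R, Z k ij.1 ij.2 @[k --> U] --> l.
  exact: bounded_ultra_cvg.
have [f hf] := choice h.
by exists (\matrix_(i, j) f (i, j)) => i j; rewrite mxE; exact: (hf (i, j)).
Qed.

Lemma mxcvg_cst (p q : nat) (L : 'M[R]_(p, q)) : mxcvg (fun=> L) L.
Proof. by move=> i j; exact: cvg_cst. Qed.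

Lemma mxcvgB (p q : nat) (Z Z' : nat -> 'M[R]_(p, q)) L L' :
  mxcvg Z L -> mxcvg Z' L' -> mxcvg (fun k => Z k - Z' k) (L - L').
Proof.
move=> h h' i j; rewrite !mxE.
under eq_fun do rewrite !mxE.
by apply: cvgB; [exact: h|exact: h'].
Qed.

Lemma mxcvgM (p q r : nat) (Z : nat -> 'M[R]_(p, q)) (Z' : nat -> 'M[R]_(q, r)) L L' :
  mxcvg Z L -> mxcvg Z' L' -> mxcvg (fun k => Z k *m Z' k) (L *m L').
Proof.
move=> h h' i j; rewrite !mxE.
under eq_fun do rewrite !mxE.
by apply: cvg_sum => l; apply: cvgM; [exact: h|exact: h'].
Qed.

Lemma mxcvgT (p q : nat) (Z : nat -> 'M[R]_(p, q)) L :
  mxcvg Z L -> mxcvg (fun k => (Z k)^T) L^T.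
Proof.
move=> h i j; rewrite !mxE.
by under eq_fun do rewrite !mxE; exact: h.
Qed.

Lemma mxcvg_tr (p : nat) (Z : nat -> 'M[R]_p) L :
  mxcvg Z L -> \tr (Z k) @[k --> U] --> \tr L.
Proof. by move=> h; apply: cvg_sum => i; exact: h. Qed.

End ultralimit.

Section quadratic_form.
Context {R : realType}.

Definition psd {n : nat} (S : 'M[R]_n) :=
  S^T = S /\ forall a : 'cV[R]_n, 0 <= (a^T *m S *m a) 0 0.

(* [qf E (E[x x^T])] is the mean square of [E x]. *)
Definition qf {p n : nat} (E : 'M[R]_(p, n)) (S : 'M[R]_n) : R :=
  \tr (E *m S *m E^T).

Lemma qfE (p n : nat) (E : 'M[R]_(p, n)) (S : 'M[R]_n) :
  qf E S = \sum_i (row i E *m S *m (row i E)^T) 0 0.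
Proof.
apply: eq_bigr => i _; rewrite tr_row !mxE.
apply: eq_bigr => k _; rewrite -row_mul !mxE.
by congr (_ * _); apply: eq_bigr => l _; rewrite !mxE.
Qed.

Lemma qf_ge0 (p n : nat) (E : 'M[R]_(p, n)) (S : 'M[R]_n) : psd S -> 0 <= qf E S.
Proof.
move=> [_ S0]; rewrite qfE; apply: sumr_ge0 => i _.
by have := S0 (row i E)^T; rewrite trmxK.
Qed.

Lemma qfDr (p n : nat) (E : 'M[R]_(p, n)) (S S' : 'M[R]_n) a b :
  qf E (a *: S + b *: S') = a * qf E S + b * qf E S'.
Proof.
by rewrite /qf mulmxDr mulmxDl mxtraceD -!scalemxAr -!scalemxAl !mxtraceZ.
Qed.

Lemma qfDl (p n : nat) (E F : 'M[R]_(p, n)) (S : 'M[R]_n) : S^T = S ->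
  qf (E + F) S = qf E S + 2 * \tr (F *m S *m E^T) + qf F S.
Proof.
move=> S_sym; rewrite /qf linearD /= !mulmxDl !mulmxDr !mxtraceD.
have -> : \tr (E *m S *m F^T) = \tr (F *m S *m E^T).
  by rewrite -[RHS]mxtrace_tr !trmx_mul trmxK S_sym mulmxA.
ring.
Qed.

Lemma qfZl (p n : nat) (E : 'M[R]_(p, n)) (S : 'M[R]_n) (t : R) :
  qf (t *: E) S = t ^+ 2 * qf E S.
Proof.
by rewrite /qf linearZ /= -!scalemxAl -scalemxAr !mxtraceZ mulrA expr2.
Qed.

Lemma qfN (p n : nat) (E : 'M[R]_(p, n)) (S : 'M[R]_n) : qf (- E) S = qf E S.
Proof. by rewrite -scaleN1r qfZl sqrrN expr1n mul1r. Qed.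

Lemma psd1 (n : nat) : psd (1%:M : 'M[R]_n).
Proof.
split; first exact: trmx1.
move=> a; rewrite mulmx1 mxE; apply: sumr_ge0 => i _.
by rewrite mxE -expr2 sqr_ge0.
Qed.

(** [qf E 1%:M] is the squared Frobenius norm of [E]; a bound on it bounds all entries, which is
    what limits along [U] require. *)
Lemma entry_le_qf1 (p n : nat) (E : 'M[R]_(p, n)) i j : E i j ^+ 2 <= qf E 1%:M.
Proof.
have -> : qf E 1%:M = \sum_i \sum_j E i j ^+ 2.
  rewrite /qf mulmx1; apply: eq_bigr => k _; rewrite !mxE; apply: eq_bigr => l _.
  by rewrite mxE expr2.
rewrite (bigD1 i) //= (bigD1 j) //= -addrA lerDl addr_ge0 //.
  by apply: sumr_ge0 => k _; exact: sqr_ge0.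
by apply: sumr_ge0 => k _; apply: sumr_ge0 => l _; exact: sqr_ge0.
Qed.

Lemma sqr_le_norm (x M : R) : x ^+ 2 <= M -> `|x| <= 1 + M.
Proof. by move=> h; rewrite ler_norml; apply/andP; split; nra. Qed.

Lemma mxcvg_qf (U : set_system nat) {UU : UltraFilter U} (p n : nat)
  (E : nat -> 'M[R]_(p, n)) (S : nat -> 'M[R]_n) E0 S0 :
  mxcvg U E E0 -> mxcvg U S S0 -> qf (E k) (S k) @[k --> U] --> qf E0 S0.
Proof.
move=> hE hS; apply: mxcvg_tr; apply: mxcvgM; last exact: mxcvgT.
exact: mxcvgM.
Qed.

End quadratic_form.

(** * Saddle points of a cost that is quadratic in the gain and linear in the second-moment
    matrix *)

Section saddle.
Context {R : realType} (U : set_system nat) {UU : UltraFilter U} (ooU : \oo `<=` U).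
Context {p q n : nat} (H : 'M[R]_(q, n)) (L : 'M[R]_(p, n)).
Variable msk : 'I_p -> 'I_q -> bool.

(** A linear subspace of gains with prescribed zeros; the mask is later the block lower triangular
    pattern that expresses causality. *)
Definition masked (K : 'M[R]_(p, q)) := forall i j, ~~ msk i j -> K i j = 0.

Let masked0 : masked 0. Proof. by move=> i j _; rewrite mxE. Qed.

Let maskedD K K' t : masked K -> masked K' -> masked (K + t *: K').
Proof. by move=> h h' i j ij; rewrite !mxE h// h'// mulr0 addr0. Qed.

(* the regularization makes the minimizer in [K] unique, which the envelope
   argument below needs when [H S H^T] is singular *)
Let g (e : R) K S : R := qf (K *m H - L) S + e * qf K 1%:M.

(** Exact second-order expansion in the gain: twice the matrix multiplied by [D] under the trace is
    the gradient at [K], up to transposition. *)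
Let gD e K D S : S^T = S ->
  g e (K + D) S = g e K S + 2 * \tr (D *m (H *m S *m (K *m H - L)^T + e *: K^T))
                  + (qf (D *m H) S + e * qf D 1%:M).
Proof.
move=> S_sym; rewrite /g mulmxDl addrAC qfDl // (qfDl K) ?trmx1 // mulmx1.
rewrite mulmxDr mxtraceD -scalemxAr mxtraceZ !mulmxA; ring.
Qed.

Let g_min (e : R) S : 0 < e -> psd S ->
  exists K, masked K /\ forall K', masked K' -> g e K S <= g e K' S.
Proof.
move=> e0 pS.
pose V := [set g e K S | K in masked].
have V0 : V !=set0 by exists (g e 0 S), 0.
have gge0 K : e * qf K 1%:M <= g e K S by rewrite lerDr qf_ge0.
have V_lb : has_lbound V.
  exists 0 => _ [K _ <-]; apply: le_trans (gge0 K).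
  by rewrite mulr_ge0 ?(ltW e0) ?qf_ge0//; exact: psd1.
have h (k : nat) : exists K, masked K /\ g e K S <= inf V + k.+1%:R^-1.
  have [] := @inf_adherent _ V (k.+1%:R^-1) _ (conj V0 V_lb); first by rewrite invr_gt0.
  by move=> _ [K mK <-] /ltW ?; exists K.
have [Z hZ] := choice h.
have [K ZK] : exists K, mxcvg U Z K.
  (* The values along the minimizing sequence are at most [inf V + 1], and the penalty alone is at
     most the value. *)
  apply: (@mxcvg_bounded _ _ _ _ _ _ (1 + (inf V + 1) / e)) => k i j.
  apply: sqr_le_norm; rewrite ler_pdivlMr // mulrC.
  apply: (@le_trans _ _ (e * qf (Z k) 1%:M)).
    by rewrite ler_pM2l // entry_le_qf1.
  apply: le_trans (gge0 _) _; apply: le_trans (hZ k).2 _.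
  by rewrite lerD2l invf_le1 // ler1n.
exists K; split.
  move=> i j ij; have := ZK i j.
  under eq_fun do rewrite (hZ _).1//.
  by move=> h0; apply/esym; apply: (@cvg_unique _ _ _ _ _ _ (cvg_cst _) h0).
move=> K' mK'; apply: (@le_trans _ _ (inf V)); last first.
  by apply: ge_inf => //; exists K'.
apply: (@ultra_ler _ U _ (fun k => g e (Z k) S) (fun k => inf V + k.+1%:R^-1)).
- apply: cvgD; last by apply: cvgM; [exact: cvg_cst|apply: mxcvg_qf => //; exact: mxcvg_cst].
  apply: mxcvg_qf; last exact: mxcvg_cst.
  by apply: mxcvgB; [apply: mxcvgM => //|]; exact: mxcvg_cst.
- rewrite -[X in _ --> X]addr0; apply: cvgD; [exact: cvg_cst|exact: ultra_harmonic].
- by move=> k; exact: (hZ k).2.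
Qed.

(** First-order optimality on a line: if [c <= 0], the values [t = 1] and [t = -1] decide; otherwise
    the minimizer [t = - l / (2 * c)] gives [- l ^+ 2 / (4 * c)]. *)
Lemma linear_coef_eq0 (l c : R) : (forall t, 0 <= t * l + t ^+ 2 * c) -> l = 0.
Proof.
move=> h.
have [c0|c0] := lerP c 0.
  by have := h 1; have := h (-1); nra.
have h0 := h (- l / (2 * c)).
have : - l / (2 * c) * l + (- l / (2 * c)) ^+ 2 * c = - (l ^+ 2 / (4 * c)).
  by field; rewrite gt_eqF.
move=> E; move: h0; rewrite E oppr_ge0 => h0.
have : l ^+ 2 <= 0.
  by move: h0; rewrite ler_pdivrMr ?mul0r // mulr_gt0.
by move=> l2; apply/eqP; rewrite -sqrf_eq0 eq_le l2 sqr_ge0.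
Qed.

(** At a minimizer over the subspace, the linear term of [gD] vanishes, and the penalty leaves
    quadratic growth. *)
Let g_strong (e : R) S K : 0 < e -> psd S -> masked K ->
  (forall K', masked K' -> g e K S <= g e K' S) ->
  forall D, masked D -> g e K S + e * qf D 1%:M <= g e (K + D) S.
Proof.
move=> e0 pS mK Kmin D mD.
rewrite gD; last exact: pS.1.
set l := \tr _; have -> : 2 * l = 0.
  apply: (@linear_coef_eq0 _ (qf (D *m H) S + e * qf D 1%:M)) => t.
  have := Kmin _ (maskedD t mK mD).
  rewrite gD; last exact: pS.1.
  rewrite -scalemxAl mxtraceZ -/l -scalemxAl !qfZl.
  by rewrite -addrA lerDl; congr (0 <= _); ring.
by rewrite addr0 lerD2l lerDr qf_ge0.
Qed.

Variable SS : set 'M[R]_n.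
Hypothesis SS_psd : forall S, SS S -> psd S.
Hypothesis SS_convex : forall S S' (t : R), 0 <= t -> t <= 1 -> SS S -> SS S' ->
  SS ((1 - t) *: S + t *: S').
Hypothesis SS_compact : forall Z : nat -> 'M[R]_n, (forall k, SS (Z k)) ->
  exists S, SS S /\ mxcvg U Z S.

Let SS_bounded : exists M, forall S, SS S -> qf L S <= M.
Proof.
apply: contrapT => /forallNP h.
have h' (k : nat) : exists S, SS S /\ k%:R < qf L S.
  have /existsNP[S /not_implyP[SSS /negP]] := h k%:R.
  by rewrite -ltNge => ?; exists S.
have [Z hZ] := choice h'.
have [S [_ ZS]] := SS_compact (fun k => (hZ k).1).
have [k] : exists k, qf L (Z k) < k%:R.
  by apply: ultra_cvg_lt_nat => //; apply: mxcvg_qf ZS; exact: mxcvg_cst.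
by rewrite ltNge (ltW (hZ k).2).
Qed.

Let g_cvg e K Z S : mxcvg U Z S -> g e K (Z k) @[k --> U] --> g e K S.
Proof.
move=> ZS; apply: cvgD; last exact: cvg_cst.
by apply: mxcvg_qf ZS; exact: mxcvg_cst.
Qed.

(** [S] is taken to maximize the value function, the minimum of [g e K S] over masked [K], and [K]
    is its minimizer there. That [S] also maximizes [g e K] is an envelope argument: on the segment
    from [S] to [S'], the minimizer moves to [K + D], and what this gains at first order in [D] is
    paid by the growth [e * qf D 1%:M]. The increase from [S] to [S'] is thus at most a constant
    times [t], for every small [t]. *)
Let g_saddle (e : R) : 0 < e -> SS !=set0 ->
  exists K S, [/\ masked K, SS S, forall S', SS S' -> g e K S' <= g e K S
    & forall K', masked K' -> g e K S <= g e K' S].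
Proof.
move=> e0 SS0.
have h S : exists K, SS S -> masked K /\ forall K', masked K' -> g e K S <= g e K' S.
  have [SSS|nS] := pselect (SS S); last by exists 0.
  by have [K] := g_min e0 (SS_psd SSS); exists K.
have [km hk] := choice h.
pose V := [set g e (km S) S | S in SS].
have V0 : V !=set0 by case: SS0 => S SSS; exists (g e (km S) S), S.
have V_ub : has_ubound V.
  have [M hM] := SS_bounded; exists M => _ [S SSS <-].
  apply: le_trans ((hk S SSS).2 _ masked0) _.
  rewrite /g mul0mx sub0r qfN /qf !mul0mx mxtrace0 mulr0 addr0.
  exact: hM.
have hZ' (k : nat) : exists S, SS S /\ sup V - k.+1%:R^-1 <= g e (km S) S.
  have [] := @sup_adherent _ V (k.+1%:R^-1) _ (conj V0 V_ub); first by rewrite invr_gt0.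
  by move=> _ [S SSS <-] /ltW ?; exists S.
have [Z hZ] := choice hZ'.
have [S [SSS ZS]] := SS_compact (fun k => (hZ k).1).
have [mK Kmin] := hk S SSS.
(* As an infimum of functions continuous in the matrix, the value function is upper semicontinuous:
   the maximizing sequence is tested against the fixed gain [km S]. *)
have maxS S' : SS S' -> g e (km S') S' <= g e (km S) S.
  move=> SSS'; apply: (@le_trans _ _ (sup V)); first by apply: ub_le_sup => //; exists S'.
  apply: (@ultra_ler _ U _ (fun k => sup V - k.+1%:R^-1) (fun k => g e (km S) (Z k))).
  - rewrite -[X in _ --> X]subr0; apply: cvgB; [exact: cvg_cst|exact: ultra_harmonic].
  - exact: g_cvg.
  - by move=> k; apply: le_trans (hZ k).2 _; apply: (hk _ (hZ k).1).2.
exists (km S), S; split => // S' SSS'.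
set K := km S.
set E := H *m S' *m (K *m H - L)^T + e *: K^T.
suff key (t : R) : 0 < t -> t <= 1 -> g e K S' - g e K S <= t * (qf E^T 1%:M / e).
  rewrite -subr_le0; apply/ler_addgt0Pr => x x0; rewrite add0r.
  set c := qf E^T 1%:M / e.
  have c0 : 0 <= c by rewrite divr_ge0 ?(ltW e0) ?qf_ge0//; exact: psd1.
  pose t := Num.min 1 (x / (c + 1)).
  have t0 : 0 < t by rewrite lt_min ltr01 /= divr_gt0 // ltr_wpDl.
  apply: le_trans (key t t0 _) _; first by rewrite ge_min lexx.
  apply: (@le_trans _ _ (x / (c + 1) * c)); first by rewrite ler_wpM2r // ge_min lexx orbT.
  by rewrite mulrAC ler_pdivrMr ?ler_wpM2l ?(ltW x0) ?lerDl ?ltr_wpDl.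
move=> t0 t1.
have SSt := SS_convex (ltW t0) t1 SSS SSS'.
set St := (1 - t) *: S + t *: S'.
have [mKt _] := hk St SSt.
set D := km St - K.
have KD : km St = K + D by rewrite /D addrC subrK.
have mD : masked D by rewrite /D -scaleN1r; exact: maskedD.
have h1 := maxS _ SSt.
have h2 : g e (km St) St = (1 - t) * g e (K + D) S + t * g e (K + D) S'.
  by rewrite KD /g qfDr; ring.
have h3 := g_strong e0 (SS_psd SSS) mK Kmin mD.
have h4 := gD e K D (SS_psd SSS').1.
have h5 : 0 <= qf (D *m H) S' by apply: qf_ge0; exact: SS_psd.
(* Completing the square in [D]: this quantity absorbs the first-order term at [S'] up to order
   [t ^+ 2]. *)
have h6 : 0 <= e * qf (D + (t / e) *: E^T) 1%:M.
  by rewrite mulr_ge0 ?(ltW e0) ?qf_ge0//; exact: psd1.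
have h7 : e * qf (D + (t / e) *: E^T) 1%:M =
   e * qf D 1%:M + 2 * t * \tr (D *m E) + t ^+ 2 * (qf E^T 1%:M / e).
  rewrite qfDl ?trmx1 // qfZl mulmx1 -scalemxAl mxtraceZ -[\tr (E^T *m _)]mxtrace_tr.
  rewrite trmx_mul !trmxK; field; exact: lt0r_neq0.
rewrite -/E in h4; rewrite -/K -/St h2 h4 in h1; rewrite h7 in h6.
set a := g e K S' in h1 *; set b := g e K S in h1 h3 *.
set d := qf D 1%:M in h1 h3 h6; set w := qf _ S' in h1 h5.
set z := \tr (D *m E) in h1 h6; set c := qf E^T _ / e in h6 *.
set y := g e (K + D) S in h1 h3.
have h8 : (1 - t) * (b + e * d) <= (1 - t) * y by rewrite ler_wpM2l // subr_ge0.
have h9 : 0 <= t * w by rewrite mulr_ge0 // ltW.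
rewrite -(ler_pM2l t0); lra.
Qed.

(** The penalty [1 / (k + 1)] vanishes along [U]. Coercivity at the single matrix [S1] bounds the
    gains: their cost at [S1] is at most their saddle value, hence at most that of the zero gain,
    which is [qf L] on [SS]. *)
Lemma masked_saddle S1 (c : R) : SS S1 -> 0 < c ->
  (forall K : 'M[R]_(p, q), c * qf K 1%:M <= qf (K *m H) S1) ->
  exists K S, [/\ masked K, SS S,
    forall S', SS S' -> qf (K *m H - L) S' <= qf (K *m H - L) S
    & forall K', masked K' -> qf (K *m H - L) S <= qf (K' *m H - L) S].
Proof.
move=> SS1 c0 coer.
have e0 (k : nat) : 0 < k.+1%:R^-1 :> R by rewrite invr_gt0.
have h (k : nat) : exists KS : 'M[R]_(p, q) * 'M[R]_n,
    [/\ masked KS.1, SS KS.2, forall S', SS S' -> g k.+1%:R^-1 KS.1 S' <= g k.+1%:R^-1 KS.1 KS.2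
    & forall K', masked K' -> g k.+1%:R^-1 KS.1 KS.2 <= g k.+1%:R^-1 K' KS.2].
  have [K [S KS]] := g_saddle (e0 k) (ex_intro _ S1 SS1).
  by exists (K, S).
have [Z hZ] := choice h.
have [M hM] := SS_bounded.
have Z2 k : SS (Z k).2 by case: (hZ k).
have Z1 k : masked (Z k).1 by case: (hZ k).
have [S [SSS ZS]] := SS_compact Z2.
have q1 (K : 'M[R]_(p, q)) : 0 <= qf K 1%:M by apply: qf_ge0; exact: psd1.
have [K ZK] : exists K, mxcvg U (fun k => (Z k).1) K.
  (* With [K H = E + L], the form [qf (E + L)] is at most [2 * qf E + 2 * qf L], and both terms are
     bounded by [M]. *)
  apply: (@mxcvg_bounded _ _ _ _ _ _ (1 + (4 * M) / c)) => k i j.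
  apply: sqr_le_norm; apply: le_trans (entry_le_qf1 _ _ _) _.
  rewrite ler_pdivlMr // mulrC; apply: le_trans (coer _) _.
  have [_ _ /(_ _ SS1) h1 /(_ _ masked0) h2] := hZ k.
  move: h2; rewrite {2}/g mul0mx sub0r qfN {2}/qf !mul0mx mxtrace0 mulr0 addr0 => h2.
  have h3 := hM _ (Z2 k).
  have h4 : qf ((Z k).1 *m H - L) S1 <= M.
    by apply: le_trans _ (le_trans h1 (le_trans h2 h3)); rewrite lerDl mulr_ge0 // ltW.
  set E := _ *m H - L in h4; have -> : (Z k).1 *m H = E + L by rewrite subrK.
  have S1_sym := (SS_psd SS1).1.
  have h5 : 0 <= qf (E + -1 *: L) S1 by apply: qf_ge0; exact: SS_psd.
  rewrite qfDl // qfZl -!scalemxAl mxtraceZ in h5; rewrite qfDl //.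
  have := hM _ SS1; lra.
have cvgE : mxcvg U (fun k => (Z k).1 *m H - L) (K *m H - L).
  by apply: mxcvgB; [apply: mxcvgM => //|]; exact: mxcvg_cst.
have cvge (K' : nat -> 'M[R]_(p, q)) K0 : mxcvg U K' K0 ->
    k.+1%:R^-1 * qf (K' k) 1%:M @[k --> U] --> (0 : R).
  move=> K'K0; rewrite -[X in _ --> X](mul0r (qf K0 1%:M)).
  by apply: cvgM; [exact: ultra_harmonic|apply: mxcvg_qf => //; exact: mxcvg_cst].
have cvgZ : g k.+1%:R^-1 (Z k).1 (Z k).2 @[k --> U] --> qf (K *m H - L) S.
  by rewrite -[X in _ --> X]addr0; apply: cvgD; [exact: mxcvg_qf|exact: cvge ZK].
exists K, S; split => //.
- move=> i j ij; have := ZK i j.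
  under eq_fun do rewrite Z1//.
  by move=> h0; apply/esym; apply: (@cvg_unique _ _ _ _ _ _ (cvg_cst _) h0).
- move=> S' SSS'.
  apply: (@ultra_ler _ U _ (fun k => g k.+1%:R^-1 (Z k).1 S') _ _ _ _ cvgZ).
    rewrite -[X in _ --> X]addr0; apply: cvgD; last exact: cvge ZK.
    by apply: mxcvg_qf => //; exact: mxcvg_cst.
  by move=> k; case: (hZ k) => _ _ + _; exact.
- move=> K' mK'.
  apply: (@ultra_ler _ U _ _ (fun k => g k.+1%:R^-1 K' (Z k).2) _ _ cvgZ).
    rewrite -[X in _ --> X]addr0; apply: cvgD; last by apply: (cvge _ K'); exact: mxcvg_cst.
    by apply: mxcvg_qf => //; exact: mxcvg_cst.
  by move=> k; case: (hZ k) => _ _ _; exact.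
Qed.

End saddle.

(** * Positive semidefinite matrices *)

Section psd_matrices.
Context {R : realType}.

Lemma qf_tr (n : nat) (a : 'cV[R]_n) (S : 'M[R]_n) : qf a^T S = (a^T *m S *m a) 0 0.
Proof. by rewrite /qf trmxK trace_mx11. Qed.

Lemma qf_mull (p q n : nat) (E : 'M[R]_(p, q)) (F : 'M[R]_(q, n)) (S : 'M[R]_n) :
  qf (E *m F) S = qf E (F *m S *m F^T).
Proof. by rewrite /qf trmx_mul !mulmxA. Qed.

Lemma psdP (n : nat) (S : 'M[R]_n) :
  S^T = S -> (forall a : 'cV[R]_n, 0 <= qf a^T S) -> psd S.
Proof. by move=> S_sym h; split => // a; rewrite -qf_tr. Qed.

Lemma psd_conj (p n : nat) (E : 'M[R]_(p, n)) (S : 'M[R]_n) :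
  psd S -> psd (E *m S *m E^T).
Proof.
move=> pS; apply: psdP; first by rewrite !trmx_mul trmxK pS.1 mulmxA.
by move=> a; rewrite -qf_mull; exact: qf_ge0.
Qed.

Lemma psdD (n : nat) (S S' : 'M[R]_n) (s t : R) : 0 <= s -> 0 <= t ->
  psd S -> psd S' -> psd (s *: S + t *: S').
Proof.
move=> s0 t0 pS pS'; apply: psdP.
  by rewrite linearD !linearZ /= pS.1 pS'.1.
by move=> a; rewrite qfDr addr_ge0 // mulr_ge0 //; exact: qf_ge0.
Qed.

Lemma qf_row_mx (p m n : nat) (A : 'M[R]_(p, m)) (B : 'M[R]_(p, n)) (G : 'M[R]_(m + n)) :
  G^T = G ->
  qf (row_mx A B) G =
  qf A (ulsubmx G) + 2 * \tr (B *m (ursubmx G)^T *m A^T) + qf B (drsubmx G).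
Proof.
move=> G_sym; have dl : dlsubmx G = (ursubmx G)^T by rewrite trmx_ursub G_sym.
rewrite /qf -{1}[G]submxK mul_row_block tr_row_mx mul_row_col dl !mulmxDl !mxtraceD.
have -> : \tr (A *m ursubmx G *m B^T) = \tr (B *m (ursubmx G)^T *m A^T).
  by rewrite -[RHS]mxtrace_tr !trmx_mul !trmxK mulmxA.
ring.
Qed.

Lemma affine_ge0_slope (l c : R) : (forall t, 0 <= c + t * l) -> l = 0.
Proof.
move=> h; apply/eqP; apply: contraT => l0.
by have := h (- (c + 1) / l); rewrite divfK //; lra.
Qed.

Lemma qf1_eq0 (p n : nat) (E : 'M[R]_(p, n)) : qf E 1%:M = 0 -> E = 0.
Proof.
move=> E0; apply/matrixP => i j; rewrite mxE; apply/eqP.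
by rewrite -sqrf_eq0 eq_le sqr_ge0 andbT -E0 entry_le_qf1.
Qed.

Lemma qf_delta (n : nat) (S : 'M[R]_n) i j (t : R) : S^T = S ->
  qf (delta_mx 0 i + t *: delta_mx 0 j : 'rV[R]_n) S
  = S i i + 2 * t * S i j + t ^+ 2 * S j j.
Proof.
move=> S_sym.
have h k l : \tr ((delta_mx 0 k : 'rV[R]_n) *m S *m (delta_mx 0 l : 'rV[R]_n)^T) = S k l.
  by rewrite trmx_delta -rowE -colE trace_mx11 !mxE.
have Sji : S j i = S i j by rewrite -[in LHS]S_sym mxE.
by rewrite qfDl // qfZl /qf -!scalemxAl mxtraceZ !h Sji; ring.
Qed.

Lemma psd_diag_ge0 (n : nat) (S : 'M[R]_n) i : psd S -> 0 <= S i i.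
Proof.
move=> pS; have := qf_ge0 (delta_mx 0 i + 0 *: delta_mx 0 i : 'rV[R]_n) pS.
by rewrite qf_delta ?pS.1 // mulr0 mul0r expr0n mul0r !addr0.
Qed.

Lemma psd_entry_le_tr (n : nat) (S : 'M[R]_n) i j : psd S -> `|S i j| <= \tr S.
Proof.
move=> pS.
have d_le k : S k k <= \tr S.
  rewrite /mxtrace (bigD1 k) //= lerDl; apply: sumr_ge0 => l _.
  exact: psd_diag_ge0.
have h t : 0 <= S i i + 2 * t * S i j + t ^+ 2 * S j j.
  by rewrite -qf_delta ?pS.1 //; exact: qf_ge0.
have := h 1; have := h (-1); have := d_le i; have := d_le j.
by rewrite ler_norml => *; apply/andP; split; lra.
Qed.

Lemma psd_diag_eq0 (n : nat) (S : 'M[R]_n) i j : psd S -> S i i = 0 -> S i j = 0.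
Proof.
move=> pS S0; suff : 2 * S i j = 0 by lra.
apply: (@affine_ge0_slope _ (S j j)) => t.
have := qf_ge0 (delta_mx 0 j + t *: delta_mx 0 i : 'rV[R]_n) pS.
rewrite qf_delta ?pS.1 // S0 mulr0 addr0.
have -> : S j i = S i j by rewrite -[in LHS]pS.1 mxE.
by congr (0 <= _); ring.
Qed.

(** If [G] is the second-moment matrix of [(xi, xi0)], then [T] is the linear regression gain of
    [xi] on [xi0], and the complement is the second-moment matrix of the residual. The block
    [drsubmx G] may be singular, so [T] comes from an inclusion of row spaces instead of an
    inverse. *)
Lemma schur_complement (m n : nat) (G : 'M[R]_(m + n)) : psd G ->
  exists2 T : 'M[R]_(m, n), ursubmx G = T *m drsubmx G
    & psd (ulsubmx G - T *m drsubmx G *m T^T).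
Proof.
move=> pG; have G_sym := pG.1.
set X := ursubmx G; set S0 := drsubmx G.
have S0_sym : S0^T = S0 by rewrite trmx_drsub G_sym.
(* [X] must kill the kernel of [S0]: on test rows whose second part lies in that kernel, the form is
   affine in [t] and nonnegative, so its slope [2 * qf A 1%:M] is zero. *)
have : (X <= S0)%MS.
  rewrite submxE; apply/eqP.
  set C := cokermx S0; have S0C : S0 *m C = 0 by exact: mulmx_coker.
  apply: trmx_inj; rewrite trmx0; apply: qf1_eq0.
  rewrite trmx_mul; set A := C^T *m X^T.
  suff : 2 * qf A 1%:M = 0 by lra.
  apply: (@affine_ge0_slope _ (qf A (ulsubmx G))) => t.
  have := qf_ge0 (row_mx A (t *: C^T)) pG.
  have q0 : qf C^T S0 = 0 by rewrite /qf trmxK -mulmxA S0C mulmx0 mxtrace0.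
  rewrite qf_row_mx // -/X -/S0 qfZl q0 mulr0 addr0 -!scalemxAl mxtraceZ -/A [qf A 1%:M]/qf mulmx1.
  by congr (0 <= _); ring.
case/submxP => T XT; exists T => //.
apply: psdP.
  rewrite linearB /= !trmx_mul trmxK S0_sym mulmxA; congr (_ - _).
  by rewrite trmx_ulsub G_sym.
(* This test row evaluates [G] on the residual [a^T (xi - T xi0)]. *)
move=> a; have := qf_ge0 (row_mx a^T (- (a^T *m T))) pG.
rewrite qf_row_mx // -/X -/S0 XT trmx_mul S0_sym qfN.
have -> : \tr (- (a^T *m T) *m (S0 *m T^T) *m a^T^T) = - qf (a^T *m T) S0.
  by rewrite !mulNmx linearN /= /qf trmx_mul !mulmxA.
rewrite -[X in _ -> 0 <= qf _ X]addr0 -[X in _ -> 0 <= qf _ (X + _)]scale1r.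
have -> : forall M N : 'M[R]_m, 1 *: (M - N) + 0 = 1 *: M + -1 *: N.
  by move=> M N; rewrite addr0 !scale1r scaleN1r.
rewrite qfDr -qf_mull; congr (0 <= _); ring.
Qed.

(** Cholesky elimination, by induction on the number [k] of leading rows that may be nonzero: the
    rank-one term of the last pivot clears its row and column, and a zero pivot means that they
    already vanish. *)
Lemma psd_sum_rank1 (n : nat) (D : 'M[R]_n) : psd D ->
  exists us : seq 'cV[R]_n, D = \sum_(u <- us) u *m u^T.
Proof.
suff: forall k (D : 'M[R]_n), psd D -> (forall i j : 'I_n, (k <= i)%N -> D i j = 0) ->
    exists us : seq 'cV[R]_n, D = \sum_(u <- us) u *m u^T.
  by move=> h pD; apply: (h n) => // i j; rewrite leqNgt ltn_ord.
elim=> [{}D _ D0|k IH {}D pD D0].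
  by exists [::]; rewrite big_nil; apply/matrixP => i j; rewrite D0 // mxE.
have D_sym i j : D i j = D j i by rewrite -[in LHS]pD.1 mxE.
have [kn|nk] := ltnP k n; last first.
  by apply: IH => // i j ki; have := leq_trans nk ki; rewrite leqNgt ltn_ord.
pose i0 := Ordinal kn.
have [d0|d0] := eqVneq (D i0 i0) 0.
  apply: IH => // i j; rewrite leq_eqVlt => /orP[/eqP ki|]; last exact: D0.
  have -> : i = i0 by apply/val_inj; rewrite /= ki.
  exact: psd_diag_eq0.
have d_gt0 : 0 < D i0 i0 by rewrite lt_neqAle eq_sym d0 psd_diag_ge0.
set d := D i0 i0 in d0 d_gt0.
pose c : 'cV[R]_n := col i0 D.
have DccE : D - d^-1 *: (c *m c^T) = 1 *: D + (- d^-1) *: (c *m c^T).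
  by rewrite scale1r scaleNr.
have [|i j|us Dus] := IH (D - d^-1 *: (c *m c^T)).
- rewrite DccE; apply: psdP.
    by rewrite linearD !linearZ /= pD.1 trmx_mul trmxK.
  move=> a; set s := (a^T *m c) 0 0.
  (* Shifting [a] along the pivot coordinate minimizes the form of [D]; the minimum is the form of
     the eliminated matrix at [a]. *)
  have := qf_ge0 (a^T + (- (s / d)) *: delta_mx 0 i0) pD.
  rewrite qfDl ?pD.1 // qfZl qfDr.
  have -> : qf (delta_mx 0 i0 : 'rV[R]_n) D = d.
    have := @qf_delta _ D i0 i0 0 pD.1; rewrite scale0r addr0 => ->.
    by rewrite -/d; ring.
  have -> : \tr ((- (s / d)) *: delta_mx 0 i0 *m D *m a^T^T) = - (s / d) * s.
    rewrite -!scalemxAl mxtraceZ -rowE -[\tr _]mxtrace_tr trmx_mul trmxK trace_mx11; congr (_ * _).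
    by rewrite /s tr_row pD.1.
  have -> : qf a^T (c *m c^T) = s ^+ 2.
    rewrite /qf mulmxA -[a^T *m c *m c^T *m _]mulmxA -trmx_mul trace_mx11 !mxE big_ord1.
    by rewrite [_^T _ _]mxE expr2 -/s.
  by congr (0 <= _); field.
- rewrite !mxE big_ord1 !mxE leq_eqVlt => /orP[/eqP ki|ki]; last first.
    by rewrite !(D0 i _ ki) mul0r mulr0 subr0.
  have -> : i = i0 by apply/val_inj; rewrite /= ki.
  by rewrite -/d mulrA mulVf // mul1r D_sym subrr.
exists (Num.sqrt d^-1 *: c :: us); rewrite big_cons -Dus.
rewrite linearZ /= -scalemxAl -scalemxAr scalerA -expr2 sqr_sqrtr ?invr_ge0 ?(ltW d_gt0) //.
by rewrite addrC subrK.
Qed.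

End psd_matrices.

(** * Second-moment matrices of couplings *)

Section coupling_matrices.
Context {R : realType} {n : nat}.

Definition diff_mx : 'M[R]_(n, n + n) := row_mx 1%:M (- 1%:M).

(* The second-moment matrices [G] of couplings [(xi, xi0)] with [E(xi0 xi0^T) = S0]
   and transport cost at most [c]. Working with [G] instead of [E(xi xi^T)] makes
   the Wasserstein constraint linear. *)
Definition coupling_mx (S0 : 'M[R]_n) (c : R) : set 'M[R]_(n + n) :=
  [set G | [/\ psd G, drsubmx G = S0 & qf diff_mx G <= c]].

Lemma qf_ulsubmx (p : nat) (E : 'M[R]_(p, n)) (G : 'M[R]_(n + n)) : G^T = G ->
  qf (row_mx E 0) G = qf E (ulsubmx G).
Proof.
by move=> G_sym; rewrite qf_row_mx // !mul0mx mxtrace0 mulr0 /qf !mul0mx mxtrace0 !addr0.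
Qed.

Lemma qf_drsubmx (p : nat) (E : 'M[R]_(p, n)) (G : 'M[R]_(n + n)) : G^T = G ->
  qf (row_mx 0 E) G = qf E (drsubmx G).
Proof.
move=> G_sym; rewrite qf_row_mx // trmx0 mulmx0 mxtrace0 mulr0 addr0.
by rewrite [qf 0 _]/qf !mul0mx mxtrace0 add0r.
Qed.

Lemma psd_ulsubmx (G : 'M[R]_(n + n)) : psd G -> psd (ulsubmx G).
Proof.
move=> pG; apply: psdP; first by rewrite trmx_ulsub pG.1.
by move=> a; rewrite -qf_ulsubmx ?pG.1 //; exact: qf_ge0.
Qed.

Lemma coupling_mx_convex S0 c G G' (t : R) : 0 <= t -> t <= 1 ->
  coupling_mx S0 c G -> coupling_mx S0 c G' ->
  coupling_mx S0 c ((1 - t) *: G + t *: G').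
Proof.
move=> t0 t1 [pG dG cG] [pG' dG' cG']; split.
- by apply: psdD => //; rewrite subr_ge0.
- transitivity ((1 - t) *: drsubmx G + t *: drsubmx G').
    by apply/matrixP => i j; rewrite !mxE.
  rewrite dG dG' -scalerDl; have -> : 1 - t + t = 1 by ring.
  by rewrite scale1r.
- rewrite qfDr; have : 0 <= 1 - t by rewrite subr_ge0.
  by move=> ?; nra.
Qed.

(** The trace of [G] is [E|xi|^2 + E|xi0|^2], and [E|xi|^2] is at most
    [2 E|xi - xi0|^2 + 2 E|xi0|^2]. *)
Lemma coupling_mx_bounded S0 c G i j :
  coupling_mx S0 c G -> `|G i j| <= 2 * c + 3 * \tr S0.
Proof.
move=> [pG dG cG]; apply: le_trans (psd_entry_le_tr _ _ pG) _.
have qf1 (m : nat) (S : 'M[R]_m) : qf 1%:M S = \tr S.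
  by rewrite /qf mul1mx trmx1 mulmx1.
rewrite -[G]submxK mxtrace_block dG -qf1 -qf_ulsubmx ?pG.1 //.
have E1 : qf (row_mx 0 1%:M : 'M[R]_(n, n + n)) G = \tr S0.
  by rewrite qf_drsubmx ?pG.1 // dG qf1.
have E2 : row_mx 1%:M 0 = diff_mx + row_mx 0 1%:M.
  by rewrite /diff_mx add_row_mx addr0 addNr.
have := qf_ge0 (diff_mx + (-1) *: row_mx 0 1%:M) pG.
rewrite E2 !(qfDl _ _ pG.1) qfZl E1 -!scalemxAl mxtraceZ.
by move: cG; set x := qf _ _; set y := \tr (_ *m _ *m _); lra.
Qed.

Lemma coupling_mx_compact (U : set_system nat) {UU : UltraFilter U} S0 c (Z : nat -> 'M[R]_(n + n)) :
  (forall k, coupling_mx S0 c (Z k)) -> exists G, coupling_mx S0 c G /\ mxcvg U Z G.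
Proof.
move=> hZ.
have [G ZG] : exists G, mxcvg U Z G.
  by apply: mxcvg_bounded => k i j; exact: coupling_mx_bounded (hZ k).
have lim_uniq (u : nat -> R) (l m : R) : u k @[k --> U] --> l -> (forall k, u k = m) -> l = m.
  move=> ul um; apply/esym; have := ul; under eq_fun do rewrite um.
  by apply: (@cvg_unique _ _ _ _ _ _ (cvg_cst _)).
exists G; split => //; split.
- split.
    apply/matrixP => i j; rewrite mxE; apply/eqP; rewrite -subr_eq0; apply/eqP.
    apply: (lim_uniq (fun k => Z k j i - Z k i j)); first by apply: cvgB; exact: ZG.
    by move=> k; have [[sZ _] _ _] := hZ k; rewrite -[in X in X - _]sZ mxE subrr.
  move=> a; rewrite -qf_tr.
  apply: (@ultra_ler _ U _ (fun=> 0) (fun k => qf a^T (Z k))); first exact: cvg_cst.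
    by apply: mxcvg_qf => //; exact: mxcvg_cst.
  by move=> k; apply: qf_ge0; case: (hZ k).
- apply/matrixP => i j; rewrite !mxE.
  apply: (lim_uniq (fun k => Z k (rshift n i) (rshift n j))); first exact: ZG.
  by move=> k; case: (hZ k) => _ <- _; rewrite !mxE.
- apply: (@ultra_ler _ U _ (fun k => qf diff_mx (Z k)) (fun=> c)).
  + by apply: mxcvg_qf => //; exact: mxcvg_cst.
  + exact: cvg_cst.
  + by move=> k; case: (hZ k).
Qed.

(** The matrix of the pair [(xi0 + noise, xi0)] with independent noise of covariance [d%:M], whose
    transport cost is [d * n]. For [d = 0] it is the identity coupling. *)
Lemma coupling_mx_shift (S0 : 'M[R]_n) (d c : R) : psd S0 -> 0 <= d -> d * n%:R <= c ->
  coupling_mx S0 c (block_mx (S0 + d%:M) S0 S0 S0).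
Proof.
move=> pS0 d0 dc.
have G_sym : (block_mx (S0 + d%:M) S0 S0 S0)^T = block_mx (S0 + d%:M) S0 S0 S0.
  by rewrite tr_block_mx linearD /= tr_scalar_mx pS0.1.
have qfG (p : nat) (A B : 'M[R]_(p, n)) :
    qf (row_mx A B) (block_mx (S0 + d%:M) S0 S0 S0) = qf (A + B) S0 + d * qf A 1%:M.
  rewrite qf_row_mx // block_mxKul block_mxKur block_mxKdr qfDl ?pS0.1 //.
  have -> : S0 + d%:M = 1 *: S0 + d *: 1%:M by rewrite scale1r scalemx1.
  by rewrite qfDr; ring.
split.
- apply: psdP => // a; rewrite -[a]vsubmxK tr_col_mx qfG addr_ge0 ?mulr_ge0 ?qf_ge0 //.
  exact: psd1.
- by rewrite block_mxKdr.
- rewrite /diff_mx qfG subrr [qf 0 _]/qf !mul0mx mxtrace0 add0r.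
  by rewrite /qf !mul1mx trmx1 mxtrace1.
Qed.

End coupling_matrices.

(** * A Cramer-Wold theorem *)

Section vector_measurability.
Context {R : realType}.

Lemma lin_funE (n : nat) (a x : 'cV[R]_n) : lin_fun a x = \sum_i a i 0 * x i 0.
Proof. by rewrite /lin_fun mxE; apply: eq_bigr => i _; rewrite mxE. Qed.

Lemma lin_funDl (n : nat) (a b x : 'cV[R]_n) : lin_fun (a + b) x = lin_fun a x + lin_fun b x.
Proof. by rewrite /lin_fun linearD /= mulmxDl mxE. Qed.

Lemma lin_funNl (n : nat) (a x : 'cV[R]_n) : lin_fun (- a) x = - lin_fun a x.
Proof. by rewrite /lin_fun linearN /= mulNmx mxE. Qed.

Lemma lin_funZl (n : nat) c (a x : 'cV[R]_n) : lin_fun (c *: a) x = c * lin_fun a x.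
Proof. by rewrite /lin_fun linearZ /= -scalemxAl mxE. Qed.

Lemma lin_fun0l (n : nat) (x : 'cV[R]_n) : lin_fun 0 x = 0.
Proof. by rewrite /lin_fun trmx0 mul0mx mxE. Qed.

Lemma lin_fun_mulmx (m n : nat) (a : 'cV[R]_m) (M : 'M[R]_(m, n)) (x : 'cV[R]_n) :
  lin_fun a (M *m x) = lin_fun (M^T *m a) x.
Proof. by rewrite /lin_fun trmx_mul trmxK mulmxA. Qed.

Lemma lin_fun_delta (n : nat) (i : 'I_n) (x : 'cV[R]_n) : lin_fun (delta_mx i 0) x = x i 0.
Proof. by rewrite /lin_fun trmx_delta -rowE mxE. Qed.

Lemma measurable_coord (n : nat) (i : 'I_n) :
  measurable_fun setT (fun v : 'cV[R]_n => v i 0).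
Proof.
move=> _ A mA; apply: sub_sigma_algebra.
by rewrite (bigD1 i) //=; left; exists A.
Qed.

Lemma measurable_cV (n : nat) d (T : measurableType d) (f : T -> 'cV[R]_n) :
  (forall i, measurable_fun setT (fun x => f x i 0)) -> measurable_fun setT f.
Proof.
move=> mf; apply: (@measurability _ _ _ _ _ _
  (\big[setU/set0]_(i < n) preimage_set_system setT (fun v : 'cV[R]_n => v i 0) measurable)) => //.
move=> _ [B hB <-]; move: hB; elim/big_ind : _ => //.
  by move=> X Y hX hY [/hX|/hY].
by move=> i _ [C mC <-]; rewrite setTI; exact: mf.
Qed.

Lemma measurable_mulmx (m n : nat) (M : 'M[R]_(m, n)) :
  measurable_fun setT (fun x : 'cV[R]_n => M *m x).
Proof.
apply: measurable_cV => i; under eq_fun do rewrite mxE.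
apply: measurable_sum => j; apply: measurable_funM => //; exact: measurable_coord.
Qed.

Lemma measurable_lin_fun (n : nat) (a : 'cV[R]_n) : measurable_fun setT (lin_fun a).
Proof.
apply: (measurableT_comp (measurable_coord (0 : 'I_1))); exact: measurable_mulmx.
Qed.

Lemma measurable_sqnorm (n : nat) : measurable_fun setT (@sqnorm R n).
Proof.
by apply: measurable_sum => i; apply: measurable_funX; exact: measurable_coord.
Qed.

End vector_measurability.

(** * Polynomial approximation of a step function *)

Section step_function.
Context {R : realType}.
Implicit Types (s u r : R) (N k : nat).

Lemma bernoulli_ineq u N : -1 <= u -> 1 + N%:R * u <= (1 + u) ^+ N.
Proof.
move=> u1; elim: N => [|N IH]; first by rewrite mul0r addr0 expr0.
rewrite exprS; apply: (@le_trans _ _ ((1 + u) * (1 + N%:R * u))); last first.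
  by rewrite ler_wpM2l //; lra.
rewrite -natr1; have : 0 <= N%:R * u ^+ 2 by rewrite mulr_ge0 ?sqr_ge0.
lra.
Qed.

(** In [1 - r ^+ k = (1 - r) (1 + r + ... + r^(k-1))], each of the [k] summands is at least
    [r ^+ k]. *)
Lemma natM_expr_le r k : 0 <= r -> r <= 1 -> k%:R * (1 - r) * r ^+ k <= 1 - r ^+ k.
Proof.
move=> r0 r1; elim: k => [|k IH]; first by rewrite !mul0r expr0 subrr.
have rk0 : 0 <= r ^+ k by exact: exprn_ge0.
have rk1 : r ^+ k <= 1 by exact: exprn_ile1.
rewrite exprS -natr1; move: (r ^+ k) (k%:R) rk0 rk1 IH => x y x0 x1 IH.
have h1 : r * (y * (1 - r) * x) <= r * (1 - x) by rewrite ler_wpM2l.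
have h2 : 0 <= (1 - r) * (1 - r * x) by rewrite mulr_ge0 ?subr_ge0 //; nra.
nra.
Qed.

(** With [q] the square root of [r], one factor [q ^+ k] absorbs [k] and the other tends to zero. *)
Lemma cvg_natM_expr r : 0 <= r -> r < 1 -> k%:R * r ^+ k @[k --> \oo] --> (0 : R).
Proof.
move=> r0 r1.
set q := Num.sqrt r; have q0 : 0 <= q by exact: sqrtr_ge0.
have q1 : q < 1 by rewrite -sqrtr1 ltr_sqrt.
have rq : r = q ^+ 2 by rewrite sqr_sqrtr.
have q1' : 0 < 1 - q by rewrite subr_gt0.
apply: (@squeeze_cvgr _ _ _ _ (fun=> 0) (fun k => (1 - q)^-1 * q ^+ k)).
- apply: nearW => k; rewrite mulr_ge0 ?exprn_ge0 //=.
  have qk0 : 0 <= q ^+ k by exact: exprn_ge0.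
  rewrite rq exprAC expr2 mulrA ler_wpM2r //.
  rewrite -(ler_pM2l q1') mulfV ?gt_eqF // mulrCA mulrA.
  have := natM_expr_le k q0 (ltW q1); nra.
- exact: cvg_cst.
- rewrite -[X in _ --> X](mulr0 (1 - q)^-1); apply: cvgM; first exact: cvg_cst.
  by apply: cvg_expr; rewrite ger0_norm.
Qed.

(* At [s = 1/2] the factor [k] in the exponent forces the limit [0]. *)
Lemma step_cvg s : 0 <= s -> s <= 1 ->
  (1 - s ^+ k) ^+ (k * 2 ^ k) @[k --> \oo] --> ((s < 2^-1)%R%:R : R).
Proof.
move=> s0 s1.
have sk0 k : 0 <= s ^+ k by exact: exprn_ge0.
have sk1 k : s ^+ k <= 1 by exact: exprn_ile1.
have E k : (k * 2 ^ k)%:R * s ^+ k = k%:R * (2 * s) ^+ k :> R.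
  by rewrite natrM natrX exprMn mulrA.
have b0 k : 0 <= (1 - s ^+ k) ^+ (k * 2 ^ k) by apply: exprn_ge0; rewrite subr_ge0.
have b1 k : (1 - s ^+ k) ^+ (k * 2 ^ k) <= 1.
  by apply: exprn_ile1; rewrite ?subr_ge0 // gerBl.
have [sh|sh] := ltP s 2^-1.
  apply: (@squeeze_cvgr _ _ _ _ (fun k => 1 - k%:R * (2 * s) ^+ k) (fun=> 1)).
  - apply: nearW => k; rewrite b1 andbT -E.
    by have := @bernoulli_ineq (- s ^+ k) (k * 2 ^ k) _; rewrite mulrN; apply; rewrite lerN2.
  - rewrite -[X in _ --> X]subr0; apply: cvgB; first exact: cvg_cst.
    by apply: cvg_natM_expr; lra.
  - exact: cvg_cst.
(* With [x = s ^+ k] and [m = k * 2 ^ k], [(1 - x)^m (1 + x)^m <= 1], and Bernoulli gives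
   [(1 + x)^m >= 1 + k (2 s)^k >= 1 + k]. *)
apply: (@squeeze_cvgr _ _ _ _ (fun=> 0) (fun k => k.+1%:R^-1)).
- apply: nearW => k; rewrite b0 /=.
  have h1 : k.+1%:R <= (1 + s ^+ k) ^+ (k * 2 ^ k).
    apply: le_trans (@bernoulli_ineq _ _ _); last by have := sk0 k; lra.
    rewrite E -natr1 addrC lerD2l -[X in X <= _]mulr1 ler_wpM2l // exprn_ege1 //; lra.
  have h2 : (1 - s ^+ k) ^+ (k * 2 ^ k) * (1 + s ^+ k) ^+ (k * 2 ^ k) <= 1.
    rewrite -exprMn; have := sk0 k; have := sk1 k; move: (s ^+ k) => x x1 x0.
    by apply: exprn_ile1; nra.
  rewrite -[X in _ <= X]mul1r ler_pdivlMr //; apply: le_trans h2.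
  by rewrite ler_wpM2l.
- exact: cvg_cst.
- exact: cvg_harmonic.
Qed.

(** The scaling brings any [y] into []-pi, pi[], where the sine has the sign of its argument; a
    half-space is thus read off a bounded periodic function. *)
Lemma sin_sign_cvg (y : R) : (sin (k.+1%:R^-1 * y) < 0)%R%:R @[k --> \oo] --> ((y < 0)%R%:R : R).
Proof.
apply: cvg_near_cst; near=> k.
have k1 : 0 < k.+1%:R^-1 :> R by rewrite invr_gt0.
have kpi : k.+1%:R^-1 * `|y| < pi.
  rewrite mulrC ltr_pdivrMr //.
  have : `|y| / pi < k.+1%:R.
    near: k; near_simpl; apply: (filterS _ (nbhs_infty_gtr (`|y| / pi))) => k /= h.
    by apply: lt_trans h _; rewrite ltr_nat.
  by rewrite ltr_pdivrMr ?pi_gt0 // mulrC.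
have [y0|y0|->] := ltgtP y 0.
- suff -> : sin (k.+1%:R^-1 * y) < 0 by [].
  rewrite -[y]opprK mulrN sinN oppr_lt0; apply: sin_gt0_pi.
  by rewrite mulr_gt0 ?oppr_gt0 //= -ltr0_norm.
- have : 0 < sin (k.+1%:R^-1 * y).
    by apply: sin_gt0_pi; rewrite mulr_gt0 //= -(gtr0_norm y0).
  by case: ltgtP.
- by rewrite mulr0 sin0 ltxx.
Unshelve. all: by end_near. Qed.

End step_function.

Section cramer_wold.
Context {R : realType} {n : nat}.
Local Notation V := 'cV[R]_n.

(* Trigonometric polynomials form an algebra, so it contains the polynomials in
   [sin (x_j / m)] that approximate indicators of half-spaces. *)
Inductive trig : (V -> R) -> Prop :=
| trig_cos a t : trig (fun x => cos (lin_fun a x + t))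
| trigD f g : trig f -> trig g -> trig (fun x => f x + g x)
| trigZ c f : trig f -> trig (fun x => c * f x).

Lemma eq_trig f g : f =1 g -> trig f -> trig g.
Proof. by move=> /funext ->. Qed.

Lemma trig_cst c : trig (fun=> c).
Proof.
apply: (@eq_trig (fun x => c * cos (lin_fun 0 x + 0))); last exact/trigZ/trig_cos.
by move=> x; rewrite lin_fun0l addr0 cos0 mulr1.
Qed.

Lemma trigM f g : trig f -> trig g -> trig (fun x => f x * g x).
Proof.
move=> tf tg; elim: tf => {f} [a t|f1 f2 _ h1 _ h2|c f _ h]; last 2 first.
- by apply: eq_trig (trigD h1 h2) => x; rewrite mulrDl.
- by apply: eq_trig (trigZ c h) => x; rewrite mulrA.
elim: tg => {g} [b u|g1 g2 _ h1 _ h2|c g _ h]; last 2 first.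
- by apply: eq_trig (trigD h1 h2) => x; rewrite mulrDr.
- by apply: eq_trig (trigZ c h) => x; rewrite mulrCA.
apply: eq_trig (trigZ 2^-1 (trigD (trig_cos (a + b) (t + u)) (trig_cos (a - b) (t - u)))) => x.
have -> : lin_fun (a + b) x + (t + u) = (lin_fun a x + t) + (lin_fun b x + u).
  by rewrite lin_funDl; ring.
have -> : lin_fun (a - b) x + (t - u) = (lin_fun a x + t) - (lin_fun b x + u).
  by rewrite lin_funDl lin_funNl; ring.
by rewrite cosB cosD; field.
Qed.

Lemma trigX f k : trig f -> trig (fun x => f x ^+ k).
Proof.
move=> tf; elim: k => [|k IH]; first exact: trig_cst.
by apply: eq_trig (trigM tf IH) => x; rewrite exprS.
Qed.

Lemma trig_sin a t : trig (fun x => sin (lin_fun a x + t)).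
Proof. by apply: eq_trig (trig_cos a (t - pi / 2)) => x; rewrite addrA cosBpihalf. Qed.

Lemma trig_measurable f : trig f -> measurable_fun setT f.
Proof.
elim=> [a t|g h _ mg _ mh|c g _ mg].
- apply: (measurableT_comp (continuous_measurable_fun (@continuous_cos R))).
  by apply: measurable_funD => //; exact: measurable_lin_fun.
- exact: measurable_funD.
- exact: measurable_funM.
Qed.

Lemma trig_bounded f : trig f -> exists M, forall x, `|f x| <= M.
Proof.
elim=> [a t|g h _ [M hM] _ [N hN]|c g _ [M hM]].
- by exists 1 => x; rewrite ler_norml cos_geN1 cos_le1.
- by exists (M + N) => x; apply: le_trans (ler_normD _ _) (lerD (hM x) (hN x)).
- by exists (`|c| * M) => x; rewrite normrM ler_wpM2l.
Qed.

Variables P Q : probability V R.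
Hypothesis same_cos : forall a t,
  (\int[P]_x (cos (lin_fun a x + t))%:E = \int[Q]_x (cos (lin_fun a x + t))%:E)%E.

Let same (f : V -> R) := (\int[P]_x (f x)%:E = \int[Q]_x (f x)%:E)%E.

Let bounded_integrable (m : probability V R) (f : V -> R) M : measurable_fun setT f ->
  (forall x, `|f x| <= M) -> m.-integrable setT (EFin \o f).
Proof.
move=> mf fM; apply: measurable_bounded_integrable => //.
  by rewrite -ge0_fin_numE // fin_num_measure.
exists M; split; first exact: num_real.
by move=> N MN x _; apply: le_trans (fM x) (ltW MN).
Qed.

Let trig_integrable (m : probability V R) (f : V -> R) :
  trig f -> m.-integrable setT (EFin \o f).
Proof.
by move=> tf; have [M] := trig_bounded tf; apply: bounded_integrable; exact: trig_measurable.
Qed.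

Let trig_same f : trig f -> same f.
Proof.
elim=> [//|g h tg sg th sh|c g tg sg]; rewrite /same.
- under eq_integral do rewrite EFinD; under [RHS]eq_integral do rewrite EFinD.
  by rewrite !integralD //=; try exact: trig_integrable; rewrite sg sh.
- under eq_integral do rewrite EFinM; under [RHS]eq_integral do rewrite EFinM.
  by rewrite !integralZl //=; try exact: trig_integrable; rewrite sg.
Qed.

Let same_lim (f_ : nat -> V -> R) (f : V -> R) (M : R) :
  (forall k, measurable_fun setT (f_ k)) -> measurable_fun setT f ->
  (forall k x, `|f_ k x| <= M) -> (forall x, f_ k x @[k --> \oo] --> f x) ->
  (forall k, same (f_ k)) -> same f.
Proof.
move=> mf_ mf fM f_f sf.
have lim (m : probability V R) :
    (\int[m]_x (f_ k x)%:E @[k --> \oo] --> \int[m]_x (f x)%:E)%E.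
  have [] := @dominated_convergence _ _ _ m setT measurableT
      (fun k x => (f_ k x)%:E) (EFin \o f) (cst M%:E).
  - by move=> k; exact/measurable_EFinP.
  - exact/measurable_EFinP.
  - by apply: aeW => x _; apply/cvg_EFin; [exact: nearW|exact: f_f].
  - by apply: (@bounded_integrable _ _ `|M|).
  - by apply: aeW => x k _; rewrite lee_fin.
  - by [].
have := lim P; under eq_fun do rewrite sf.
by move=> limP; exact: (cvg_unique _ limP (lim Q)).
Qed.

(** A pi-system generating the Borel sets, built one half-space at a time to allow induction on the
    number of indicators. *)
Inductive corner : set V -> Prop :=
| cornerT : corner setT
| cornerI A j b : corner A -> corner (A `&` [set x | x j 0 < b]).

Let corner_measurable A : corner A -> measurable A.
Proof.
elim=> // {}A j b _ mA; apply: measurableI => //.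
have := @measurable_coord R n j measurableT `]-oo, b[%classic (measurable_itv _).
congr (measurable _); rewrite setTI.
by apply/seteqP; split => x /=; rewrite in_itv.
Qed.

(** The factor [g] makes the induction work: the polynomial approximating the indicator of the new
    half-space is absorbed into it. Two dominated limits follow, in the degree [k] and then in the
    scale [m]. *)
Let corner_same A : corner A -> forall g, trig g -> same (fun x => \1_A x * g x).
Proof.
elim=> [g tg|{}A j b cA IH g tg].
  by rewrite /same; under eq_integral do rewrite indicT mul1r;
     under [RHS]eq_integral do rewrite indicT mul1r; exact: trig_same.
have mA := corner_measurable cA.
have [M gM] := trig_bounded tg.
have mg := trig_measurable tg.
have m1A : measurable_fun setT (\1_A : V -> R) by exact: measurable_indic.
have A1 x : `|\1_A x : R| <= 1 by rewrite indicE; case: (_ \in _); rewrite ?normr1 ?normr0.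
have bnd (x : V) (y : R) : `|y| <= 1 -> `|\1_A x * (y * g x)| <= M.
  move=> y1; rewrite !normrM; have := gM x; have := A1 x.
  have := normr_ge0 (\1_A x : R); have := normr_ge0 y; have := normr_ge0 (g x).
  move: `|\1_A x| `|y| `|g x| y1 => u v w v1 w0 v0 u0 u1 wM.
  have : u * (v * w) <= 1 * (1 * w) by apply: ler_pM => //; [exact: mulr_ge0|apply: ler_pM].
  by lra.
pose y (m : nat) (x : V) : R := sin (m.+1%:R^-1 * (x j 0 - b)).
have tri_y m : trig (y m).
  apply: eq_trig (trig_sin (m.+1%:R^-1 *: delta_mx j 0) (- (m.+1%:R^-1 * b))) => x.
  by rewrite lin_funZl lin_fun_delta -mulrBr.
have my m := trig_measurable (tri_y m).
have step1 m : same (fun x => \1_A x * ((y m x < 0)%R%:R * g x)).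
  (* The range of the sine is moved to [[0, 1]], so that a negative sine becomes [s x < 2^-1], the
     threshold of [step_cvg]. *)
  pose s (x : V) := 2^-1 * (1 + y m x).
  have s01 x : 0 <= s x /\ s x <= 1.
    by rewrite /s /y; split; have := sin_geN1 (m.+1%:R^-1 * (x j 0 - b));
       have := sin_le1 (m.+1%:R^-1 * (x j 0 - b)); lra.
  have tri_s : trig s by apply: trigZ; apply: trigD => //; exact: trig_cst.
  have tri k : trig (fun x => (1 - s x ^+ k) ^+ (k * 2 ^ k)).
    apply: trigX; apply: eq_trig (trigD (trig_cst 1) (trigZ (-1) (trigX k tri_s))) => x.
    by rewrite mulN1r.
  apply: (@same_lim (fun k x => \1_A x * ((1 - s x ^+ k) ^+ (k * 2 ^ k) * g x)) _ M).
  - move=> k; apply: measurable_funM => //; apply: measurable_funM => //.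
    exact: trig_measurable.
  - apply: measurable_funM => //; apply: measurable_funM => //.
    apply: (measurableT_comp (measurable_funTS _)) => //.
    exact: measurable_fun_ltr.
  - move=> k x; apply: bnd; have [s0 s1] := s01 x.
    have sk1 : s x ^+ k <= 1 by exact: exprn_ile1.
    have sk0 : 0 <= s x ^+ k by exact: exprn_ge0.
    by rewrite ger0_norm ?exprn_ge0 ?exprn_ile1 ?subr_ge0 // gerBl.
  - move=> x; apply: cvgM; first exact: cvg_cst.
    apply: cvgM; last exact: cvg_cst.
    have -> : (y m x < 0) = (s x < 2^-1).
      by rewrite /s -[X in _ = (_ < X)]mulr1 ltr_pM2l ?invr_gt0 // gtrDl.
    by have [s0 s1] := s01 x; exact: step_cvg.
  - by move=> k; apply: IH; exact: trigM.
rewrite /same.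
have E x : \1_(A `&` [set x | x j 0 < b]) x * g x = \1_A x * ((x j 0 - b < 0)%R%:R * g x).
  rewrite indicI /= mulrA; congr (_ * _ * _).
  by rewrite indicE mem_setE subr_lt0.
under eq_integral do rewrite E; under [RHS]eq_integral do rewrite E.
apply: (@same_lim (fun m x => \1_A x * ((y m x < 0)%R%:R * g x)) _ M) => //.
- move=> m; apply: measurable_funM => //; apply: measurable_funM => //.
  apply: (measurableT_comp (measurable_funTS _)) => //.
  exact: measurable_fun_ltr.
- apply: measurable_funM => //; apply: measurable_funM => //.
  apply: (measurableT_comp (measurable_funTS _)) => //.
  apply: measurable_fun_ltr => //; apply: measurable_funB => //; exact: measurable_coord.
- by move=> m x; apply: bnd; case: (_ < 0); rewrite ?normr1 ?normr0.
- move=> x; apply: cvgM; first exact: cvg_cst.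
  by apply: cvgM; [exact: sin_sign_cvg|exact: cvg_cst].
Qed.

(** Uniqueness of characteristic functions in real form: the phase [t] in [same_cos] accounts for
    the sine part. *)
Lemma eq_probability_cos A : measurable A -> P A = Q A.
Proof.
apply: (@measure_unique _ _ _ corner (fun=> setT)).
- apply/seteqP; split => X; last first.
    by apply: smallest_sub; [exact: sigma_algebra_measurable|exact: corner_measurable].
  apply: smallest_sub; first exact: smallest_sigma_algebra.
  move=> B; elim/big_ind : _ => //.
    by move=> Y Z hY hZ [/hY|/hZ].
  move=> i _ [C mC <-].
  have mi : measurable_fun (setT : set (g_sigma_algebraType corner)) (fun v : V => v i 0).
    apply: (measurability _ (RGenInftyO.measurableE R)) => _ [_ [b ->] <-].
    apply: sub_sigma_algebra.
    have -> : setT `&` (fun v : V => v i 0) @^-1` `]-oo, b[ = setT `&` [set v : V | v i 0 < b].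
      by rewrite !setTI; apply/seteqP; split => v /=; rewrite in_itv.
    exact/cornerI/cornerT.
  exact: mi.
- move=> X Y cX; elim=> [|{}Y j b _ IH]; first by rewrite setIT.
  by rewrite setIA; exact: cornerI.
- by move=> _; exact: cornerT.
- by apply/seteqP; split => // x _; exists 0.
- move=> X cX; have := corner_same cX (trig_cst 1).
  rewrite /same; under eq_integral do rewrite mulr1; under [RHS]eq_integral do rewrite mulr1.
  by rewrite !integral_indic ?setIT //; exact: corner_measurable.
- by move=> _; rewrite -ge0_fin_numE // fin_num_measure.
Qed.

End cramer_wold.

(** * The normal distribution *)

Section normal_distribution.
Context {R : realType}.
Local Notation mu := (@lebesgue_measure R).
Local Notation std := (normal_prob (0 : R) 1).

Lemma lebesgue_measure_affine (m s : R) (A : set R) : s != 0 -> measurable A ->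
  (mu A = `|s|%:E * mu ((fun x => (m + s * x)%R) @^-1` A))%E.
Proof.
move=> s0 mA.
have mphi : measurable_fun setT (fun x : measurableTypeR R => m + s * x : measurableTypeR R).
  by apply: measurable_funD => //; exact: measurable_funM.
pose nu := mscale (NngNum (normr_ge0 s)) (pushforward mu (fun x : measurableTypeR R => m + s * x : measurableTypeR R)).
suff -> : mu A = nu mphi A by [].
apply: lebesgue_measure_unique => // X [[a b] /= _ <-].
rewrite /nu /mscale /= /pushforward.
have [sneg|spos|s00] := ltgtP s 0; last by rewrite s00 eqxx in s0.
- have -> : (fun x => m + s * x) @^-1` `]a, b] = `[(b - m) / s, (a - m) / s[%classic.
    apply/seteqP; split => x /=; rewrite !in_itv /= ltr_ndivlMr // ler_ndivrMr //;
    by rewrite andbC mulrC ltrBlDl lerBrDl.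
  rewrite !lebesgue_measure_itv /= !lte_fin ltr_nM2r ?invr_lt0 // ltrD2r.
  case: ifP => _; last by rewrite mule0.
  by rewrite -!EFinB -EFinM ltr0_norm //; congr EFin; field.
- have -> : (fun x => m + s * x) @^-1` `]a, b] = `](a - m) / s, (b - m) / s]%classic.
    apply/seteqP; split => x /=; rewrite !in_itv /= ltr_pdivrMr // ler_pdivlMr //;
    by rewrite mulrC ltrBlDl lerBrDl.
  rewrite !lebesgue_measure_itv /= !lte_fin ltr_pM2r ?invr_gt0 // ltrD2r.
  case: ifP => _; last by rewrite mule0.
  by rewrite -!EFinB -EFinM gtr0_norm //; congr EFin; field.
Qed.

Lemma normal_pdf_affine (m s x : R) : s != 0 ->
  normal_pdf m `|s| (m + s * x) * `|s| = normal_pdf 0 1 x.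
Proof.
move=> s0; rewrite !normal_pdfE ?normr_eq0 ?oner_eq0 // /normal_peak /normal_fun.
rewrite real_normK ?num_real // expr1n mul1r subr0 mulrAC; congr (_ * expR _).
  rewrite -mulrnAr sqrtrM ?sqr_ge0 // sqrtr_sqr invfM mulrAC mulVf ?mul1r // normr_eq0 //.
by field.
Qed.

(** The image of the standard law under an affine map, including the Dirac mass at [s = 0] and
    negative [s]. *)
Lemma normal1_law (m s : R) (A : set R) : measurable A ->
  normal1 m (s ^+ 2) A = std ((fun z => m + s * z) @^-1` A).
Proof.
move=> mA; rewrite /normal1 sqrf_eq0; have [->|s0] := eqVneq s 0.
  have -> : (fun z : R => m + 0 * z) = cst m by apply/funext => z; rewrite mul0r addr0.
  rewrite diracE preimage_cst; case: ifP => _; rewrite ?measure0 //.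
  by rewrite probability_setT.
have mphi : measurable_fun setT (fun x : measurableTypeR R => m + s * x : measurableTypeR R).
  by apply: measurable_funD => //; exact: measurable_funM.
pose nu := mscale (NngNum (normr_ge0 s)) (pushforward mu (fun x : measurableTypeR R => m + s * x : measurableTypeR R)).
rewrite sqrtr_sqr /normal_prob.
have mpdf : measurable_fun setT (EFin \o normal_pdf m `|s|).
  by apply/measurable_EFinP; exact: measurable_normal_pdf.
rewrite (@eq_measure_integral _ _ _ _ (nu mphi));
  last by move=> B mB _; exact: lebesgue_measure_affine.
rewrite ge0_integral_mscale //=; last 2 first.
- exact: measurable_funTS.
- by move=> x _; rewrite lee_fin normal_pdf_ge0.
rewrite (ge0_integral_pushforward mphi) //; last 2 first.
- exact: measurable_funTS.
- by move=> x _; rewrite lee_fin normal_pdf_ge0.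
rewrite -ge0_integralZl //=; last 3 first.
- by rewrite -[X in measurable X]setTI; exact: mphi.
- by apply: measurable_funTS; exact: (measurableT_comp mpdf).
- by move=> x _; rewrite lee_fin normal_pdf_ge0.
by apply: eq_integral => x _; rewrite -EFinM mulrC normal_pdf_affine.
Qed.

Lemma ge0_integral_normal_prob (m s : R) (f : R -> \bar R) :
  measurable_fun setT f -> (forall x, 0 <= f x)%E ->
  (\int[normal_prob m s]_x f x = \int[mu]_x (f x * (normal_pdf m s x)%:E))%E.
Proof.
move=> mf f0; have dom := @normal_prob_dominates R m s.
rewrite -(Radon_Nikodym_SigmaFinite.change_of_variables dom) //.
have iRN := Radon_Nikodym_SigmaFinite.f_integrable dom.
have mpdf : measurable_fun setT (EFin \o normal_pdf m s).
  by apply/measurable_EFinP; exact: measurable_normal_pdf.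
apply: ae_eq_integral => //.
- by apply: emeasurable_funM => //; exact: measurable_int iRN.
- exact: emeasurable_funM.
apply: ae_eqe_mul2l; apply: integral_ae_eq => //.
by move=> E _ mE; rewrite -Radon_Nikodym_SigmaFinite.f_integral.
Qed.

(** Tilting by the exponential of a quadratic only changes the variance, so integrals of the tilted
    density are explicit; the second moment is derived from this. *)
Lemma normal_pdf_tilt (t x : R) : 0 < t ->
  expR ((1 - t ^- 2) / 2 * x ^+ 2) * normal_pdf 0 1 x = t * normal_pdf 0 t x.
Proof.
move=> t0; rewrite !normal_pdfE ?oner_eq0 ?gt_eqF // /normal_peak /normal_fun.
rewrite expr1n mul1r !subr0 mulrCA -expRD -mulrnAr sqrtrM ?sqr_ge0 // sqrtr_sqr gtr0_norm //.
rewrite (invfM t (Num.sqrt _)) [RHS]mulrA (mulrA t) mulfV ?gt_eqF // mul1r; congr (_ * expR _).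
by field; rewrite gt_eqF.
Qed.

Lemma normal_second_moment : (\int[std]_x (x ^+ 2)%:E = 1)%E.
Proof.
have msq : measurable_fun setT (fun x : R => (x ^+ 2)%:E).
  by apply/measurable_EFinP; exact: measurable_funX.
have mp m s : measurable_fun setT (fun x : measurableTypeR R => (normal_pdf m s x)%:E).
  by apply/measurable_EFinP; exact: measurable_normal_pdf.
have p0 m s x : (0 <= (normal_pdf m s x)%:E :> \bar R)%E by rewrite lee_fin normal_pdf_ge0.
rewrite ge0_integral_normal_prob //; last by move=> x; rewrite lee_fin sqr_ge0.
set I := (\int[mu]_x _)%E.
have mq : measurable_fun setT (fun x : measurableTypeR R => (x ^+ 2)%:E * (normal_pdf 0 1 x)%:E)%E.
  exact: emeasurable_funM.
have q0 x : (0 <= (x ^+ 2)%:E * (normal_pdf 0 1 x)%:E :> \bar R)%E.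
  by rewrite mule_ge0 // lee_fin sqr_ge0.
have I0 : (0 <= I)%E by exact: integral_ge0.
have Et t : 0 <= t -> (t%:E = \int[mu]_x (t%:E * (normal_pdf 0 t x)%:E))%E.
  by move=> t0; rewrite -[LHS]mule1 -(integral_normal_pdf 0 t) -ge0_integralZl ?lee_fin.
(* [1 + u x^2 <= exp (u x^2)], integrated against the standard normal density,
   bounds the second moment from above for [u > 0] and from below for [u < 0] *)
have ub t : 1 < t -> (1 + ((1 - t ^- 2) / 2)%:E * I <= t%:E)%E.
  move=> t1; have t0 : 0 < t by exact: lt_trans ltr01 t1.
  have u0 : 0 <= (1 - t ^- 2) / 2.
    by rewrite divr_ge0 // subr_ge0 invf_le1 ?exprn_gt0 // exprn_ege1 // ltW.
  rewrite (Et t (ltW t0)) -(integral_normal_pdf 0 1) -ge0_integralZl ?lee_fin //.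
  rewrite -ge0_integralD //; last 2 first.
  - by move=> x _; rewrite mule_ge0 // lee_fin.
  - exact: measurable_funeM.
  apply: ge0_le_integral => //.
  - by move=> x _; rewrite adde_ge0 // mule_ge0 // lee_fin.
  - by apply: emeasurable_funD => //; exact: measurable_funeM.
  - exact: measurable_funeM.
  - move=> x _; rewrite -!EFinM -EFinD lee_fin -normal_pdf_tilt // mulrA -{1}[normal_pdf 0 1 x]mul1r -mulrDl.
    by rewrite ler_wpM2r ?normal_pdf_ge0 // expR_ge1Dx.
have lb t : 0 < t -> t < 1 -> (1 <= t%:E + ((t ^- 2 - 1) / 2)%:E * I)%E.
  move=> t0 t1.
  have u0 : 0 <= (t ^- 2 - 1) / 2.
    by rewrite divr_ge0 // subr_ge0 invf_ge1 ?exprn_gt0 // exprn_ile1 // ltW.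
  rewrite (Et t (ltW t0)) -{1}(integral_normal_pdf 0 1) -ge0_integralZl ?lee_fin //.
  rewrite -ge0_integralD //; last 4 first.
  - by move=> x _; rewrite mule_ge0 // lee_fin ltW.
  - exact: measurable_funeM.
  - by move=> x _; rewrite mule_ge0 // lee_fin.
  - exact: measurable_funeM.
  apply: ge0_le_integral => //.
  - by apply: emeasurable_funD; exact: measurable_funeM.
  - move=> x _; rewrite -!EFinM -EFinD lee_fin -normal_pdf_tilt // mulrA -{1}[normal_pdf 0 1 x]mul1r -mulrDl.
    rewrite ler_wpM2r ?normal_pdf_ge0 //.
    have := expR_ge1Dx ((1 - t ^- 2) / 2 * x ^+ 2); lra.
have Ifin : I \is a fin_num.
  have := ub 2; rewrite ltr1n => /(_ isT); case: (I) I0 => [r _ _ //|_|//].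
  by rewrite gt0_muley // lte_fin; lra.
rewrite -(fineK Ifin) in ub lb I0 *; move: (fine I) ub lb I0 => r ub lb; rewrite lee_fin => r0.
have tq (t : R) : 0 < t -> t ^+ 2 * t ^- 2 = 1 by move=> t0; rewrite mulfV // sqrf_eq0 gt_eqF.
(* With [t = 1 + h] and [t = 1 - h], multiplying by [t ^+ 2] and dividing by [h] turns the bounds
   into [(2 + h) r <= 2 (1 + h)^2] and [2 (1 - h)^2 <= (2 - h) r], whence
   [1 - 2 h <= r <= 1 + 2 h]. *)
congr EFin; apply/eqP; rewrite eq_le; apply/andP; split.
- apply/ler_addgt0Pr => e e0.
  have [h he] : exists h, e = 2 * h by exists (e / 2); field.
  have h0 : 0 < h by lra.
  have t1 : 1 < 1 + h by rewrite ltrDl.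
  have := ub _ t1; rewrite lee_fin; have := tq (1 + h) (lt_trans ltr01 t1).
  move: ((1 + h) ^- 2) => q q1 H.
  have h1 : (1 + h) ^+ 2 * ((1 - q) * r) <= (1 + h) ^+ 2 * (2 * h).
    by rewrite ler_wpM2l ?sqr_ge0 //; lra.
  have h2 : h * ((2 + h) * r) <= h * (2 * (1 + h) ^+ 2).
    have : (1 + h) ^+ 2 * ((1 - q) * r) = ((1 + h) ^+ 2 - 1) * r.
      by rewrite mulrA mulrBr mulr1 q1.
    lra.
  have h3 : (2 + h) * r <= 2 * (1 + h) ^+ 2 by rewrite ler_pM2l in h2.
  have h4 : (2 + h) * r <= (2 + h) * (1 + 2 * h) by nra.
  by rewrite ler_pM2l in h4; lra.
- apply/ler_addgt0Pr => e e0.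
  have [e1|e1] := leP 1 e; first by lra.
  have [h he] : exists h, e = 2 * h by exists (e / 2); field.
  have h0 : 0 < h by lra.
  have h1 : h < 1 by lra.
  have t0 : 0 < 1 - h by lra.
  have t1 : 1 - h < 1 by lra.
  have := lb _ t0 t1; rewrite lee_fin; have := tq _ t0.
  move: ((1 - h) ^- 2) => q q1 H.
  have h2 : (1 - h) ^+ 2 * (2 * h) <= (1 - h) ^+ 2 * ((q - 1) * r).
    by rewrite ler_wpM2l ?sqr_ge0 //; lra.
  have h3 : h * (2 * (1 - h) ^+ 2) <= h * ((2 - h) * r).
    have : (1 - h) ^+ 2 * ((q - 1) * r) = (1 - (1 - h) ^+ 2) * r.
      by rewrite mulrA mulrBr mulr1 q1.
    lra.
  have h4 : 2 * (1 - h) ^+ 2 <= (2 - h) * r by rewrite ler_pM2l in h3.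
  have h5 : (2 - h) * (1 - 2 * h) <= (2 - h) * r by nra.
  by rewrite ler_pM2l in h5; lra.
Qed.

(** Bayes' rule for [z] standard normal and [t = c z + noise] with noise of deviation [s]: both
    sides are the joint density, the right one as the marginal of [t] times the law of [z] given
    [t]. *)
Lemma normal_pdf_mul (c s z t : R) (r := Num.sqrt (s ^+ 2 + c ^+ 2)) : 0 < s ->
  normal_pdf (c * z) s t * normal_pdf 0 1 z =
  normal_pdf 0 r t * normal_pdf (c * t / r ^+ 2) (s / r) z.
Proof.
move=> s0.
have r2 : r ^+ 2 = s ^+ 2 + c ^+ 2 by rewrite sqr_sqrtr // addr_ge0 ?sqr_ge0.
have r2_gt0 : 0 < r ^+ 2 by rewrite r2 ltr_pwDl ?exprn_gt0 ?sqr_ge0.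
have r0 : 0 < r by rewrite lt_neqAle sqrtr_ge0 andbT eq_sym -sqrf_eq0 gt_eqF.
rewrite !normal_pdfE ?oner_eq0 ?gt_eqF ?divr_gt0 // /normal_peak /normal_fun.
have peakE (u : R) : 0 < u -> (Num.sqrt (u ^+ 2 * pi *+ 2))^-1 = u^-1 * (Num.sqrt (pi *+ 2))^-1.
  by move=> u0; rewrite -mulrnAr sqrtrM ?sqr_ge0 // sqrtr_sqr gtr0_norm // invfM.
rewrite !peakE ?divr_gt0 //; set k := (Num.sqrt (pi *+ 2))^-1.
have -> (a b x y : R) : a * k * expR x * (b * k * expR y) = a * b * k ^+ 2 * expR (x + y).
  by rewrite expRD; ring.
have -> (a b x y : R) : a * k * expR x * (b * k * expR y) = a * b * k ^+ 2 * expR (x + y).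
  by rewrite expRD; ring.
congr (_ * _ * expR _); first by field; rewrite !gt_eqF.
have s2c2 : s ^+ 2 + c ^+ 2 != 0 by rewrite -r2 gt_eqF.
rewrite expr_div_n r2; field.
by rewrite s2c2 gt_eqF.
Qed.

(** By Tonelli and the factorization of the joint density, the inner integral over [z] is that of a
    normal density, equal to 1. A zero [v] gives Dirac masses and is treated apart. *)
Lemma normal1_convolution (c v : R) (S : set R) : 0 <= v -> measurable S ->
  (\int[std]_z normal1 (c * z) v S = normal1 0 (v + c ^+ 2) S)%E.
Proof.
move=> v0 mS; have [->|vn0] := eqVneq v 0.
  rewrite add0r normal1_law //.
  have -> : (fun z : R => 0 + c * z) @^-1` S = (fun z : R => c * z) @^-1` S.
    by apply/seteqP; split => z /=; rewrite add0r.
  transitivity (\int[std]_z (\1_((fun z : R => c * z) @^-1` S) z)%:E)%E.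
    by apply: eq_integral => z _; rewrite /normal1 eqxx diracE indicE.
  have mc : measurable_fun setT (fun z : R => c * z) by exact: measurable_funM.
  have mcS := mc measurableT S mS; rewrite setTI in mcS.
  by have := @integral_indic _ _ _ std setT measurableT _ mcS; rewrite setIT; exact.
have v_gt0 : 0 < v by rewrite lt_neqAle eq_sym vn0.
set s := Num.sqrt v; have s0 : 0 < s by rewrite sqrtr_gt0.
have vE : v = s ^+ 2 by rewrite sqr_sqrtr.
have r0 : v + c ^+ 2 != 0 by rewrite gt_eqF // ltr_pwDl ?sqr_ge0.
have mpdf2 : measurable_fun setT (fun p : measurableTypeR R * measurableTypeR R =>
    (normal_pdf (c * p.1) s p.2 * \1_S p.2)%:E).
  have m1S : measurable_fun setT (\1_S : measurableTypeR R -> R) by exact: measurable_indic.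
  apply/measurable_EFinP; apply: measurable_funM; last first.
    exact: (measurableT_comp m1S measurable_snd).
  under eq_fun do rewrite normal_pdfE ?gt_eqF //.
  rewrite /normal_fun; apply: measurable_funM => //.
  apply: (measurableT_comp (@measurable_expR R)).
  apply: measurable_funM => //; apply: measurable_funN; apply: measurable_funX.
  apply: measurable_funB; first exact: measurable_snd.
  by apply: measurable_funM => //; exact: measurable_fst.
have f0 (p : measurableTypeR R * measurableTypeR R) :
    (0 <= (normal_pdf (c * p.1) s p.2 * \1_S p.2)%:E :> \bar R)%E.
  by rewrite lee_fin mulr_ge0 ?normal_pdf_ge0.
have pdfS m u : normal_prob m u S = (\int[mu]_t (normal_pdf m u t * \1_S t)%:E)%E.
  by rewrite /normal_prob integral_mkcond epatch_indic.
rewrite {2}/normal1 (negbTE r0) vE.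
have sn0 : (s ^+ 2 == 0) = false by rewrite -vE (negbTE vn0).
under eq_integral do rewrite /normal1 sn0 sqrtr_sqr gtr0_norm // pdfS.
rewrite ge0_integral_normal_prob; last 2 first.
- exact: (measurable_fun_fubini_tonelli_F (m2 := mu) _ mpdf2 f0).
- by move=> z; apply: integral_ge0 => t _; exact: (f0 (z, t)).
have mphi : measurable_fun setT (fun z : measurableTypeR R => (normal_pdf 0 1 z)%:E).
  by apply/measurable_EFinP; exact: measurable_normal_pdf.
transitivity (\int[mu]_z \int[mu]_t
    ((normal_pdf (c * z) s t * \1_S t)%:E * (normal_pdf 0 1 z)%:E))%E.
  apply: eq_integral => z _; rewrite ge0_integralZr //.
  - exact: (measurableT_comp mpdf2 (measurable_pair1 z)).
  - by move=> t _; exact: (f0 (z, t)).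
  - by rewrite lee_fin normal_pdf_ge0.
rewrite (fubini_tonelli (m1 := mu) (m2 := mu) (fun p : measurableTypeR R * measurableTypeR R =>
   (normal_pdf (c * p.1) s p.2 * \1_S p.2)%:E * (normal_pdf 0 1 p.1)%:E)%E); last 2 first.
- by apply: emeasurable_funM => //; exact: (measurableT_comp mphi measurable_fst).
- by move=> p; rewrite mule_ge0 ?f0 // lee_fin normal_pdf_ge0.
rewrite pdfS; apply: eq_integral => t _ /=.
set r := Num.sqrt _.
transitivity (\int[mu]_z ((normal_pdf 0 r t * \1_S t)%:E *
    (normal_pdf (c * t / r ^+ 2) (s / r) z)%:E))%E.
  apply: eq_integral => z _; rewrite -!EFinM mulrAC normal_pdf_mul // mulrAC.
  by congr EFin.
rewrite ge0_integralZl //.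
- by rewrite integral_normal_pdf mule1.
- by apply/measurable_EFinP; exact: measurable_normal_pdf.
- by move=> z _; rewrite lee_fin normal_pdf_ge0.
- by rewrite lee_fin mulr_ge0 ?normal_pdf_ge0.
Qed.

End normal_distribution.

(** * Centered Gaussian vectors *)

Section image_law.
Context d d' {T : measurableType d} {T' : measurableType d'} {R : realType}.

(** Carries its two proofs as arguments so that the measure and probability structures can be
    attached to the term. *)
Definition image_law (mu : {measure set T -> \bar R}) (f : T -> T')
  (mf : measurable_fun setT f) (mu1 : mu setT = 1%E) : set T' -> \bar R := pushforward mu f.

Section instances.
Variables (mu : {measure set T -> \bar R}) (f : T -> T').
Variables (mf : measurable_fun setT f) (mu1 : mu setT = 1%E).

Let law0 : image_law mf mu1 set0 = 0%E.
Proof. by rewrite /image_law /pushforward preimage_set0 measure0. Qed.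

Let law_ge0 A : (0 <= image_law mf mu1 A)%E.
Proof. exact: measure_ge0. Qed.

Let law_sigma_additive : semi_sigma_additive (image_law mf mu1).
Proof.
pose m := pushforward mu f : {measure set T' -> \bar R}.
by have := @measure_semi_sigma_additive _ _ _ (m mf); exact.
Qed.

HB.instance Definition _ := isMeasure.Build _ _ _ (image_law mf mu1)
  law0 law_ge0 law_sigma_additive.

Let law_setT : image_law mf mu1 setT = 1%E.
Proof. by rewrite /image_law /pushforward preimage_setT. Qed.

HB.instance Definition _ := Measure_isProbability.Build _ _ _ (image_law mf mu1) law_setT.

End instances.

Lemma image_law_exists (mu : {measure set T -> \bar R}) (f : T -> T') :
  measurable_fun setT f -> mu setT = 1%E ->
  exists Q : probability T' R, forall A, measurable A -> Q A = mu (f @^-1` A).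
Proof. by move=> mf mu1; exists (image_law mf mu1). Qed.

Lemma ge0_integral_image_law (mu : {measure set T -> \bar R}) (Q : probability T' R)
    (f : T -> T') (h : T' -> \bar R) : measurable_fun setT f ->
  (forall A, measurable A -> Q A = mu (f @^-1` A)) ->
  measurable_fun setT h -> (forall y, 0 <= h y)%E ->
  (\int[Q]_y h y = \int[mu]_x h (f x))%E.
Proof.
move=> mf QE mh h0.
pose m := pushforward mu f : {measure set T' -> \bar R}.
rewrite (@eq_measure_integral _ _ _ _ (m mf)); last by move=> A mA _; exact: QE.
by rewrite (ge0_integral_pushforward mf) // preimage_setT.
Qed.

End image_law.

Section centered_gaussian.
Context {R : realType}.
Local Notation std := (normal_prob (0 : R) 1).

Definition centered_gaussian {n : nat} (P : probability 'cV[R]_n R) (S : 'M[R]_n) :=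
  psd S /\ forall (a : 'cV[R]_n) (A : set R), measurable A ->
    P (lin_fun a @^-1` A) = normal1 0 (qf a^T S) A.

(** The matrix in [gaussian_with_mean] may fail to be symmetric; its symmetric part has the same
    quadratic form. *)
Lemma gaussian_with_mean0 (n : nat) (P : probability 'cV[R]_n R) :
  gaussian_with_mean 0 P -> exists S, centered_gaussian P S.
Proof.
move=> [S [S0 PS]]; exists (2^-1 *: S + 2^-1 *: S^T).
have E (a : 'cV[R]_n) : qf a^T (2^-1 *: S + 2^-1 *: S^T) = (a^T *m S *m a) 0 0.
  have -> : (a^T *m S *m a) 0 0 = qf a^T S by rewrite qf_tr.
  have ET : qf a^T S^T = qf a^T S.
    by rewrite /qf -[RHS]mxtrace_tr !trmx_mul !trmxK mulmxA.
  by rewrite qfDr ET; field.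
split.
  apply: psdP; first by rewrite linearD !linearZ /= trmxK addrC.
  by move=> a; rewrite E.
move=> a A mA; rewrite (PS _ _ mA) E.
by have -> : lin_fun a 0 = 0 by rewrite /lin_fun mulmx0 mxE.
Qed.

Lemma centered_gaussianW (n : nat) (P : probability 'cV[R]_n R) S :
  centered_gaussian P S -> gaussian P.
Proof.
move=> [pS PS]; exists 0, S; split; first exact: pS.2.
move=> a A mA; rewrite (PS _ _ mA) qf_tr.
by have -> : lin_fun a 0 = 0 by rewrite /lin_fun mulmx0 mxE.
Qed.

Lemma normal1_std (m v : R) (A : set R) : 0 <= v -> measurable A ->
  normal1 m v A = std ((fun z => m + Num.sqrt v * z) @^-1` A).
Proof. by move=> v0 mA; rewrite -(normal1_law _ _ mA) (sqr_sqrtr v0). Qed.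

Lemma centered_gaussian_mulmx (m n : nat) (P : probability 'cV[R]_n R) S
    (M : 'M[R]_(m, n)) (Q : probability 'cV[R]_m R) :
  centered_gaussian P S ->
  (forall A, measurable A -> Q A = P ((fun x => M *m x) @^-1` A)) ->
  centered_gaussian Q (M *m S *m M^T).
Proof.
move=> [pS PS] QE; split; first exact: psd_conj.
move=> a A mA; rewrite QE; last first.
  by rewrite -[X in measurable X]setTI; exact: measurable_lin_fun.
have -> : (fun x : 'cV[R]_n => M *m x) @^-1` (lin_fun a @^-1` A) = lin_fun (M^T *m a) @^-1` A.
  by apply/seteqP; split => x /=; rewrite lin_fun_mulmx.
by rewrite (PS _ _ mA) trmx_mul trmxK qf_mull.
Qed.

(** [Q] is the law of [x + z u] with [z] an independent standard normal variable. The second clause,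
    on events invariant along [u], later shows that one component of a pair keeps its law. *)
Lemma centered_gaussian_addZ (n : nat) (P : probability 'cV[R]_n R) S (u : 'cV[R]_n) :
  centered_gaussian P S ->
  exists Q : probability 'cV[R]_n R, centered_gaussian Q (S + u *m u^T) /\
    forall A, measurable A -> (forall x c, A (x + c *: u) <-> A x) -> Q A = P A.
Proof.
move=> [pS PS].
pose f (p : 'cV[R]_n * measurableTypeR R) : 'cV[R]_n := p.1 + (p.2 : R) *: u.
have mf : measurable_fun setT f.
  apply: measurable_cV => i; under eq_fun do rewrite !mxE.
  apply: measurable_funD; first exact: (measurableT_comp (measurable_coord i) measurable_fst).
  by apply: measurable_funM => //; exact: measurable_snd.
pose PN : {measure set ('cV[R]_n * measurableTypeR R) -> \bar R} := (P \x^ std)%E.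
have PNE B : PN B = (\int[std]_z P (ysection B z))%E by [].
have PN1 : PN setT = 1%E.
  rewrite PNE; under eq_integral do rewrite ysectionE preimage_setT probability_setT.
  by rewrite integral_cst // mul1e; exact: probability_setT.
have [Q QE] := image_law_exists mf PN1.
exists Q; split; last first.
  move=> A mA Au; rewrite QE // PNE.
  rewrite (eq_integral (fun=> P A)); last first.
    move=> z _; congr (P _); rewrite ysectionE.
    by apply/seteqP; split => x /=; rewrite /f /= Au.
  rewrite integral_cst // -[RHS]mule1; congr (_ * _)%E; exact: probability_setT.
have uuE (a : 'cV[R]_n) : qf a^T (u *m u^T) = lin_fun a u ^+ 2.
  rewrite /qf mulmxA -[a^T *m u *m u^T *m _]mulmxA -trmx_mul trace_mx11 mxE big_ord1.
  by rewrite [_^T _ _]mxE expr2.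
split.
  rewrite -[S]scale1r -[u *m u^T]scale1r; apply: psdD => //.
  apply: psdP; first by rewrite trmx_mul trmxK.
  by move=> a; rewrite uuE sqr_ge0.
move=> a A mA.
have mlA : measurable (lin_fun a @^-1` A).
  by rewrite -[X in measurable X]setTI; exact: measurable_lin_fun.
have v0 := qf_ge0 a^T pS.
rewrite QE // PNE -[S]scale1r -[u *m u^T]scale1r qfDr !mul1r uuE -(normal1_convolution _ v0 mA).
apply: eq_integral => z _.
pose c := lin_fun a u.
have msh : measurable ((fun t : R => t + c * z) @^-1` A).
  rewrite -[X in measurable X]setTI.
  by have mc : measurable_fun setT (fun t : R => t + c * z);
    [exact: measurable_funD|exact: mc].
have -> : ysection (f @^-1` (lin_fun a @^-1` A)) z = lin_fun a @^-1` ((fun t : R => t + c * z) @^-1` A).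
  rewrite ysectionE; apply/seteqP; split => x /=;
  by rewrite /f /c !lin_funE mulr_suml -big_split /=;
     congr (A _); apply: eq_bigr => i _; rewrite !mxE; ring.
rewrite (PS _ _ msh) (normal1_std _ v0 msh) (normal1_std _ v0 mA); congr (std _).
by apply/seteqP; split => t /=; rewrite add0r addrC.
Qed.

Lemma centered_gaussian_addZs (n : nat) (P : probability 'cV[R]_n R) S (us : seq 'cV[R]_n) :
  centered_gaussian P S ->
  exists Q : probability 'cV[R]_n R, centered_gaussian Q (S + \sum_(u <- us) u *m u^T) /\
    forall A, measurable A -> (forall u, u \in us -> forall x c, A (x + c *: u) <-> A x) ->
      Q A = P A.
Proof.
elim: us P S => [|u us IH] P S PS.
  by exists P; rewrite big_nil addr0.
have [Q [QS QE]] := centered_gaussian_addZ u PS.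
have [Q' [QS' QE']] := IH _ _ QS; exists Q'; rewrite big_cons addrA; split => //.
move=> A mA Aus; rewrite QE' //; last first.
  by move=> v vus; apply: Aus; rewrite inE vus orbT.
by apply: QE => //; apply: Aus; rewrite inE eqxx.
Qed.

Lemma centered_gaussian_moment (n : nat) (P : probability 'cV[R]_n R) S (a : 'cV[R]_n) :
  centered_gaussian P S -> (\int[P]_x (lin_fun a x ^+ 2)%:E = (qf a^T S)%:E)%E.
Proof.
move=> [pS PS]; have v0 := qf_ge0 a^T pS; set v := qf _ _ in v0 *.
have msq : measurable_fun setT (fun t : R => (t ^+ 2)%:E).
  by apply/measurable_EFinP; exact: measurable_funX.
have sq0 (t : R) : (0 <= (t ^+ 2)%:E)%E by rewrite lee_fin sqr_ge0.
have mz : measurable_fun setT (fun z : R => 0 + Num.sqrt v * z).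
  by apply: measurable_funD => //; exact: measurable_funM.
have [Q QE] := image_law_exists (@measurable_lin_fun R n a) (probability_setT P).
rewrite -(ge0_integral_image_law (measurable_lin_fun a) QE msq sq0).
have QE' A : measurable A -> Q A = std ((fun z : R => 0 + Num.sqrt v * z) @^-1` A).
  by move=> mA; rewrite -(normal1_std 0 v0 mA) -(PS _ _ mA) (QE _ mA).
rewrite (@ge0_integral_image_law _ _ (measurableTypeR R) _ R std Q _ _ mz QE' msq sq0).
under eq_integral do rewrite add0r exprMn sqr_sqrtr // EFinM.
rewrite ge0_integralZl //.
by rewrite normal_second_moment mule1.
Qed.

Lemma sqnorm_mulmx (p n : nat) (E : 'M[R]_(p, n)) (x : 'cV[R]_n) :
  sqnorm (E *m x) = \sum_i lin_fun (row i E)^T x ^+ 2.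
Proof.
by rewrite /sqnorm; apply: eq_bigr => i _; rewrite /lin_fun trmxK -row_mul [in RHS]mxE.
Qed.

Lemma centered_gaussian_sqnorm (p n : nat) (P : probability 'cV[R]_n R) S (E : 'M[R]_(p, n)) :
  centered_gaussian P S -> (\int[P]_x (sqnorm (E *m x))%:E = (qf E S)%:E)%E.
Proof.
move=> PS; under eq_integral do rewrite sqnorm_mulmx -sumEFin.
rewrite ge0_integral_sum //; last 2 first.
- move=> i; apply/measurable_EFinP; apply: measurable_funX; exact: measurable_lin_fun.
- by move=> i x _; rewrite lee_fin sqr_ge0.
under eq_bigr do rewrite (centered_gaussian_moment _ PS) trmxK.
rewrite sumEFin qfE; congr EFin; apply: eq_bigr => i _.
by rewrite /qf trace_mx11.
Qed.

Lemma sqnorm_ge0 (n : nat) (x : 'cV[R]_n) : 0 <= sqnorm x.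
Proof. by apply: sumr_ge0 => i _; exact: sqr_ge0. Qed.

Lemma diff_mx_col (n : nat) (x y : 'cV[R]_n) : diff_mx *m col_mx x y = x - y.
Proof. by rewrite mul_row_col mul1mx mulNmx mul1mx. Qed.

(** The pair [(T xi0 + noise, xi0)] has second-moment matrix exactly [G]. Its noise is added along
    vectors [col_mx u 0], and events on the second component are invariant along these, so that
    component keeps the law [P0] itself and the pair is a true coupling. *)
Lemma coupling_mx_gaussian (n : nat) (P0 : probability 'cV[R]_n R) S0 c G :
  centered_gaussian P0 S0 -> coupling_mx S0 c G ->
  exists P : probability 'cV[R]_n R,
    centered_gaussian P (ulsubmx G) /\ (W2sq P P0 <= c%:E)%E.
Proof.
move=> P0S [pG dG cG].
have [T uG pD] := schur_complement pG; rewrite dG in uG pD.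
have [us usE] := psd_sum_rank1 pD.
pose M : 'M[R]_(n + n, n) := col_mx T 1%:M.
have [Q0 Q0E] := image_law_exists (measurable_mulmx M) (probability_setT P0).
have Q0S := centered_gaussian_mulmx P0S Q0E.
have [Q [QS QE]] := centered_gaussian_addZs [seq col_mx u 0 | u <- us] Q0S.
have GE : M *m S0 *m M^T + \sum_(u <- [seq col_mx u 0 | u <- us]) u *m u^T = G.
  have -> : \sum_(u <- [seq col_mx u (0 : 'cV[R]_n) | u <- us]) u *m u^T =
            block_mx (ulsubmx G - T *m S0 *m T^T) 0 0 0.
    rewrite usE big_map; elim: (us) => [|u vs IH].
      by rewrite !big_nil block_mx0.
    rewrite !big_cons IH tr_col_mx trmx0 mul_col_row !mulmx0 !mul0mx add_block_mx.
    by rewrite !addr0.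
  have S0_sym : S0^T = S0 by rewrite -dG trmx_drsub pG.1.
  rewrite /M tr_col_mx trmx1 mul_col_mx mul1mx mul_col_row !mulmx1 add_block_mx !addr0.
  rewrite addrC subrK -[RHS]submxK dG uG; congr block_mx.
  by rewrite -[RHS]trmxK trmx_dlsub pG.1 uG trmx_mul S0_sym.
rewrite GE in QS.
have mus : measurable_fun setT (fun z : 'cV[R]_(n + n) => usubmx z).
  by apply: measurable_cV => i; under eq_fun do rewrite mxE; exact: measurable_coord.
have mds : measurable_fun setT (fun z : 'cV[R]_(n + n) => dsubmx z).
  by apply: measurable_cV => i; under eq_fun do rewrite mxE; exact: measurable_coord.
have [P PE] := image_law_exists mus (probability_setT Q).
exists P; split.
  have E (z : 'cV[R]_(n + n)) : usubmx z = (row_mx 1%:M 0 : 'M[R]_(n, n + n)) *m z.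
    by rewrite -{2}[z]vsubmxK mul_row_col mul1mx mul0mx addr0.
  have PE' A : measurable A -> P A = Q ((fun z => (row_mx 1%:M 0 : 'M[R]_(n, n + n)) *m z) @^-1` A).
    by move=> mA; rewrite PE //; congr (Q _); apply/seteqP; split => z /=; rewrite E.
  have := centered_gaussian_mulmx QS PE'; congr centered_gaussian.
  rewrite -{1}[G]submxK mul_row_block tr_row_mx mul_row_col !mul1mx !mul0mx !addr0.
  by rewrite trmx1 trmx0 mulmx1 mulmx0 addr0.
pose pr (z : 'cV[R]_(n + n)) := (usubmx z, dsubmx z).
have mpr : measurable_fun setT pr by exact: measurable_fun_pair.
have [g gE] := image_law_exists mpr (probability_setT Q).
have cpl : coupling P P0 g.
  move=> A mA; split.
    rewrite gE; last exact: measurableX.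
    by rewrite PE //; congr (Q _); apply/seteqP; split => z /=; [case|].
  rewrite gE; last exact: measurableX.
  have -> : pr @^-1` (setT `*` A) = (fun z : 'cV[R]_(n + n) => dsubmx z) @^-1` A.
    by apply/seteqP; split => z /=; [case|].
  have mdA : measurable ((fun z : 'cV[R]_(n + n) => dsubmx z) @^-1` A).
    by rewrite -[X in measurable X]setTI; exact: mds.
  transitivity (Q0 ((fun z : 'cV[R]_(n + n) => dsubmx z) @^-1` A)); last first.
    rewrite Q0E //; congr (P0 _); apply/seteqP; split => x /=;
    by rewrite /M mul_col_mx col_mxKd mul1mx.
  apply: QE => // _ /mapP[u _ ->] x r /=.
  have -> // : dsubmx (x + r *: col_mx u 0) = dsubmx x.
  transitivity (dsubmx x + r *: dsubmx (col_mx u 0)).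
    by apply/matrixP => i j; rewrite !mxE.
  by rewrite col_mxKd scaler0 addr0.
apply: le_trans (_ : (\int[g]_z (sqnorm (z.1 - z.2))%:E)%E <= _)%E.
  by apply: ereal_inf_lbound; exists g.
have mh : measurable_fun setT (fun z : 'cV[R]_n * 'cV[R]_n => (sqnorm (z.1 - z.2))%:E).
  apply/measurable_EFinP; apply: measurable_sum => i; under eq_fun do rewrite !mxE.
  apply: measurable_funX; apply: measurable_funB.
    exact: (measurableT_comp (measurable_coord i) measurable_fst).
  exact: (measurableT_comp (measurable_coord i) measurable_snd).
rewrite (ge0_integral_image_law mpr gE mh); last by move=> z; rewrite lee_fin sqnorm_ge0.
rewrite (eq_integral (fun z => (sqnorm (diff_mx *m z))%:E)); last first.
  by move=> z _; rewrite -[in RHS](vsubmxK z) diff_mx_col.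
by rewrite (centered_gaussian_sqnorm _ QS) lee_fin.
Qed.

End centered_gaussian.

(** * Second moments and the Wasserstein ball *)

Section second_moments.
Context {R : realType}.

Lemma sym_eq_qf (n : nat) (S S' : 'M[R]_n) : S^T = S -> S'^T = S' ->
  (forall a : 'cV[R]_n, qf a^T S = qf a^T S') -> S = S'.
Proof.
move=> sS sS' h; apply/matrixP => i j.
have E t : S i i + 2 * t * S i j + t ^+ 2 * S j j = S' i i + 2 * t * S' i j + t ^+ 2 * S' j j.
  have := h (delta_mx 0 i + t *: delta_mx 0 j)^T.
  by rewrite trmxK (qf_delta _ _ _ sS) (qf_delta _ _ _ sS').
by have := E 1; have := E (-1); lra.
Qed.

Lemma second_moment_mx d (X : measurableType d) (mu : probability X R) (m : nat)
    (Z : X -> 'cV[R]_m) : measurable_fun setT Z ->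
  (\int[mu]_x (sqnorm (Z x))%:E < +oo)%E ->
  exists2 G, psd G &
    forall p (E : 'M[R]_(p, m)), (\int[mu]_x (sqnorm (E *m Z x))%:E = (qf E G)%:E)%E.
Proof.
move=> mZ Zfin.
have mZi i : measurable_fun setT (fun x => Z x i 0).
  exact: (measurableT_comp (measurable_coord i) mZ).
have iS : mu.-integrable setT (fun x => (sqnorm (Z x))%:E).
  apply/integrableP; split.
    by apply/measurable_EFinP; exact: (measurableT_comp (@measurable_sqnorm R m) mZ).
  by under eq_integral do rewrite gee0_abs ?lee_fin ?sqnorm_ge0 //.
have le1 (x : 'cV[R]_m) i : x i 0 ^+ 2 <= sqnorm x.
  by rewrite /sqnorm (bigD1 i) //= lerDl; apply: sumr_ge0 => j _; exact: sqr_ge0.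
have iZ (ij : 'I_m * 'I_m) : mu.-integrable setT (fun x => (Z x ij.1 0 * Z x ij.2 0)%:E).
  apply: le_integrable iS => //.
    by apply/measurable_EFinP; exact: measurable_funM.
  move=> x _; rewrite lee_fin [leRHS]ger0_norm ?sqnorm_ge0 //.
  have := le1 (Z x) ij.1; have := le1 (Z x) ij.2.
  by move: (Z x _ _) (Z x _ _) => a b; rewrite ler_norml => *; apply/andP; split; nra.
pose G : 'M[R]_m := \matrix_(i, j) fine (\int[mu]_x (Z x i 0 * Z x j 0)%:E).
have GE ij : (\int[mu]_x (Z x ij.1 0 * Z x ij.2 0)%:E = (G ij.1 ij.2)%:E)%E.
  by rewrite mxE fineK //; apply: integrable_fin_num => //; exact: iZ.
have sqE p (E : 'M[R]_(p, m)) (z : 'cV[R]_m) :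
    sqnorm (E *m z) = \sum_(ij : 'I_m * 'I_m) (E^T *m E) ij.1 ij.2 * (z ij.1 0 * z ij.2 0).
  rewrite -(pair_bigA _ (fun i j => (E^T *m E) i j * (z i 0 * z j 0))) /=.
  transitivity (qf z^T (E^T *m E)).
    rewrite /qf trmxK -mulmxA -mulmxA mulmxA -trmx_mul trace_mx11 mxE /sqnorm.
    by apply: eq_bigr => i _; rewrite [_^T _ _]mxE expr2.
  rewrite /qf trmxK trace_mx11 mxE exchange_big /=; apply: eq_bigr => j _.
  rewrite mxE mulr_suml; apply: eq_bigr => i _; rewrite [z^T _ _]mxE; ring.
have intE p (E : 'M[R]_(p, m)) : (\int[mu]_x (sqnorm (E *m Z x))%:E = (qf E G)%:E)%E.
  under eq_integral do rewrite sqE -sumEFin.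
  rewrite integral_sum //; last first.
    by move=> ij; under eq_fun do rewrite EFinM; apply: integrableZl => //; exact: iZ.
  have h ij : (\int[mu]_x ((E^T *m E) ij.1 ij.2 * (Z x ij.1 0 * Z x ij.2 0))%:E =
      ((E^T *m E) ij.1 ij.2 * G ij.1 ij.2)%:E)%E.
    by under eq_integral do rewrite EFinM; rewrite integralZl ?GE //; exact: iZ.
  under eq_bigr do rewrite h.
  rewrite sumEFin; congr EFin.
  rewrite -(pair_bigA _ (fun i j => (E^T *m E) i j * G i j)) /= /qf mxtrace_mulC mulmxA.
  apply: eq_bigr => i _; rewrite mxE; apply: eq_bigr => j _; congr (_ * _).
  by rewrite !mxE; congr fine; apply: eq_integral => x _; rewrite mulrC.
exists G => //; apply: psdP.
  apply/matrixP => i j; rewrite !mxE; congr fine.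
  by apply: eq_integral => x _; rewrite mulrC.
move=> a; rewrite -lee_fin -intE; apply: integral_ge0 => x _.
by rewrite lee_fin sqnorm_ge0.
Qed.

Lemma W2_le (n : nat) (P P0 : probability 'cV[R]_n R) (rho : R) : 0 <= rho ->
  (W2 P P0 <= rho%:E)%E = (W2sq P P0 <= (rho ^+ 2)%:E)%E.
Proof.
move=> rho0; have : (0 <= W2sq P P0)%E.
  apply: le_ereal_inf_tmp => _ [g _ <-]; apply: integral_ge0 => z _.
  by rewrite lee_fin sqnorm_ge0.
rewrite /W2; case: (W2sq P P0) => [r r0||//]; last by rewrite !leNgt !ltry.
rewrite !lee_fin; rewrite lee_fin in r0.
by rewrite -(ler_sqr (sqrtr_ge0 _) rho0) sqr_sqrtr.
Qed.

(** The cost of an arbitrary law in the ball depends only on its second-moment matrix, so it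
    suffices to place the matrices of its near-optimal couplings, after a small correction, in
    [coupling_mx]. *)
Lemma ambiguity_bound (n p : nat) (P0 P : probability 'cV[R]_n R) S0 (rho V : R)
    (E : 'M[R]_(p, n)) :
  0 < rho -> centered_gaussian P0 S0 ->
  (forall G, coupling_mx S0 (rho ^+ 2) G -> qf E (ulsubmx G) <= V) ->
  ambiguity P0 rho P -> (\int[P]_x (sqnorm (E *m x))%:E <= V%:E)%E.
Proof.
move=> rho0 P0S hV [Pfin]; rewrite (W2_le _ _ (ltW rho0)) => W2P.
have [pS0 _] := P0S.
have rho2 : 0 < rho ^+ 2 by rewrite exprn_gt0.
have G0c : coupling_mx S0 (rho ^+ 2) (block_mx (S0 + 0%:M) S0 S0 S0).
  by apply: coupling_mx_shift => //; rewrite mul0r ltW.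
have [Sg pSg SgE] := second_moment_mx (@measurable_id _ _ setT) Pfin.
rewrite SgE lee_fin; set q := qf E Sg.
have V0 : 0 <= V.
  by apply: le_trans (hV _ G0c); apply: qf_ge0; apply: psd_ulsubmx; case: G0c.
(* an [eps]-optimal coupling is pulled into the ball by mixing it with the identity coupling *)
suff key (eps : R) : 0 < eps -> rho ^+ 2 * q <= V * (rho ^+ 2 + eps).
  have : rho ^+ 2 * q <= rho ^+ 2 * V.
    apply/ler_addgt0Pr => e e0.
    have := key (e / (V + 1)) (divr_gt0 e0 (ltr_wpDl V0 ltr01)).
    have : V * (e / (V + 1)) <= e.
      by rewrite mulrCA (ler_piMr (ltW e0)) // ler_pdivrMr ?ltr_wpDl // mul1r lerDl.
    by rewrite mulrDr; lra.
  by rewrite ler_pM2l.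
move=> eps0.
have : (W2sq P P0 < (rho ^+ 2 + eps)%:E)%E.
  by apply: le_lt_trans W2P _; rewrite lte_fin ltrDl.
move=> /ereal_inf_lt[_ [g cpl <-] gcost].
have m1 : measurable_fun setT (fun z : 'cV[R]_n * 'cV[R]_n => z.1) by exact: measurable_fst.
have m2 : measurable_fun setT (fun z : 'cV[R]_n * 'cV[R]_n => z.2) by exact: measurable_snd.
have g1 A : measurable A -> P A = g ((fun z => z.1) @^-1` A).
  move=> mA; rewrite -(cpl A mA).1; congr (g _).
  by apply/seteqP; split => z //= [].
have g2 A : measurable A -> P0 A = g ((fun z => z.2) @^-1` A).
  move=> mA; rewrite -(cpl A mA).2; congr (g _).
  by apply/seteqP; split => z //= [].
have msq k (F : 'M[R]_(k, n)) : measurable_fun setT (fun x : 'cV[R]_n => (sqnorm (F *m x))%:E).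
  by apply/measurable_EFinP; exact: (measurableT_comp (@measurable_sqnorm R k) (measurable_mulmx F)).
have sq0 k (F : 'M[R]_(k, n)) x : (0 <= (sqnorm (F *m x))%:E)%E by rewrite lee_fin sqnorm_ge0.
have int1 k (F : 'M[R]_(k, n)) := ge0_integral_image_law m1 g1 (msq k F) (sq0 k F).
have int2 k (F : 'M[R]_(k, n)) := ge0_integral_image_law m2 g2 (msq k F) (sq0 k F).
pose Z (z : 'cV[R]_n * 'cV[R]_n) : 'cV[R]_(n + n) := col_mx z.1 z.2.
have mZ : measurable_fun setT Z.
  apply: measurable_cV => i; under eq_fun do rewrite mxE.
  case: (fintype.split i) => j; first exact: (measurableT_comp (measurable_coord j) m1).
  exact: (measurableT_comp (measurable_coord j) m2).
have Zfin : (\int[g]_z (sqnorm (Z z))%:E < +oo)%E.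
  have ZE z : sqnorm (Z z) = sqnorm (1%:M *m z.1) + sqnorm (1%:M *m z.2).
    rewrite !mul1mx /sqnorm big_split_ord /=; congr (_ + _); apply: eq_bigr => i _.
      by rewrite col_mxEu.
    by rewrite col_mxEd.
  under eq_integral do rewrite ZE EFinD.
  rewrite ge0_integralD //; last 2 first.
  - exact: (measurableT_comp (msq _ 1%:M) m1).
  - exact: (measurableT_comp (msq _ 1%:M) m2).
  rewrite -int1 -int2 (centered_gaussian_sqnorm _ P0S) lte_add_pinfty ?ltry //.
  by under eq_integral do rewrite mul1mx.
have [G pG GE] := second_moment_mx mZ Zfin.
have G_sym := pG.1.
have G1 k (F : 'M[R]_(k, n)) : qf F (ulsubmx G) = qf F Sg.
  apply: EFin_inj; rewrite -qf_ulsubmx // -GE -SgE int1; apply: eq_integral => z _.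
  by rewrite /Z mul_row_col mul0mx addr0.
have G2 : drsubmx G = S0.
  apply: sym_eq_qf; [by rewrite trmx_drsub G_sym|exact: pS0.1|].
  move=> a; apply: EFin_inj; rewrite -qf_drsubmx // -GE -(centered_gaussian_sqnorm _ P0S) int2.
  by apply: eq_integral => z _; rewrite /Z mul_row_col mul0mx add0r.
have G3 : qf diff_mx G <= rho ^+ 2 + eps.
  rewrite -lee_fin -GE; apply: ltW; apply: le_lt_trans gcost.
  by under eq_integral do rewrite /Z diff_mx_col.
have r0 : 0 < rho ^+ 2 + eps by rewrite addr_gt0.
(* Chosen so that [(1 - t) * (rho ^+ 2 + eps) = rho ^+ 2]; the identity coupling has transport cost
   zero. *)
pose t := eps / (rho ^+ 2 + eps).
have t0 : 0 <= t by rewrite divr_ge0 // ltW.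
have t1 : 1 - t = rho ^+ 2 / (rho ^+ 2 + eps) by rewrite /t; field; rewrite gt_eqF.
have t1' : 0 <= 1 - t by rewrite t1 divr_ge0 // ltW.
have Gc : coupling_mx S0 (rho ^+ 2) ((1 - t) *: G + t *: block_mx (S0 + 0%:M) S0 S0 S0).
  split.
  - by apply: psdD => //; case: G0c.
  - transitivity ((1 - t) *: drsubmx G + t *: drsubmx (block_mx (S0 + 0%:M) S0 S0 S0)).
      by apply/matrixP => i j; rewrite !mxE.
    by rewrite G2 block_mxKdr -scalerDl subrK scale1r.
  - have Z0 : qf diff_mx (block_mx (S0 + 0%:M) S0 S0 S0) <= 0.
      have h0 : (0 : R) * n%:R <= 0 by rewrite mul0r.
      by case: (coupling_mx_shift pS0 (lexx 0) h0).
    have h1 : (1 - t) * qf diff_mx G <= rho ^+ 2.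
      apply: (@le_trans _ _ ((1 - t) * (rho ^+ 2 + eps))); first by rewrite ler_wpM2l.
      by rewrite t1 divfK ?gt_eqF.
    have h2 : t * qf diff_mx (block_mx (S0 + 0%:M) S0 S0 S0) <= 0.
      by rewrite mulr_ge0_le0.
    by rewrite qfDr; lra.
have := hV _ Gc.
have -> : ulsubmx ((1 - t) *: G + t *: block_mx (S0 + 0%:M) S0 S0 S0) =
    (1 - t) *: ulsubmx G + t *: (S0 + 0%:M).
  transitivity ((1 - t) *: ulsubmx G + t *: ulsubmx (block_mx (S0 + 0%:M) S0 S0 S0)).
    by apply/matrixP => i j; rewrite !mxE.
  by rewrite block_mxKul.
rewrite qfDr G1 -/q => h.
have : 0 <= t * qf E (S0 + 0%:M).
  by rewrite mulr_ge0 // qf_ge0 // -scalemx1 scale0r addr0.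
move=> h2; have h3 : (1 - t) * q <= V by lra.
by move: h3; rewrite t1 mulrAC ler_pdivrMr.
Qed.

(** Each cosine integral depends only on the law of one projection, which [S] determines. *)
Lemma eq_centered_gaussian (n : nat) (P Q : probability 'cV[R]_n R) S A :
  centered_gaussian P S -> centered_gaussian Q S -> measurable A -> P A = Q A.
Proof.
move=> [_ PS] [_ QS]; apply: eq_probability_cos => a t.
have mc : measurable_fun setT (fun y : R => (cos (y + t))%:E).
  apply/measurable_EFinP; apply: (measurableT_comp (continuous_measurable_fun (@continuous_cos R))).
  exact: measurable_funD.
have int (P' : probability 'cV[R]_n R) :
    P'.-integrable setT ((fun y : R => (cos (y + t))%:E) \o lin_fun a).
  apply: (measurable_bounded_integrable (f := fun x => cos (lin_fun a x + t))) => //.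
  - by rewrite -ge0_fin_numE // fin_num_measure.
  - by apply/measurable_EFinP; exact: (measurableT_comp mc (measurable_lin_fun a)).
  - exists 1; split; first exact: num_real.
    move=> M M1 x _ /=; apply: le_trans (ltW M1).
    by rewrite ler_norml cos_geN1 cos_le1.
pose m (P' : probability 'cV[R]_n R) := pushforward P' (lin_fun a) : {measure set R -> \bar R}.
have := integral_pushforward (measurable_lin_fun a) mc (int P) measurableT.
have := integral_pushforward (measurable_lin_fun a) mc (int Q) measurableT.
rewrite !preimage_setT => <- <-.
have ml := measurable_lin_fun a.
rewrite (@eq_measure_integral _ _ _ _ (m ml Q) (m ml P)) // => B mB _.
by rewrite /m /= /pushforward (PS _ _ mB) (QS _ _ mB).
Qed.

(* [lin_fun c] is independent of [M x], and only the invariance of the joint law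
   under [lin_fun c -> - lin_fun c] is needed: averaging the two signs removes the
   cross term even when [h] is not square-integrable. *)
Lemma gaussian_orthogonal_le (n m : nat) (P : probability 'cV[R]_n R) S (c : 'cV[R]_n)
    (M : 'M[R]_(m, n)) (h : 'cV[R]_m -> R) :
  centered_gaussian P S -> M *m S *m c = 0 -> measurable_fun setT h ->
  (\int[P]_x (lin_fun c x ^+ 2)%:E <= \int[P]_x ((h (M *m x) + lin_fun c x) ^+ 2)%:E)%E.
Proof.
move=> PS MSc mh.
pose N (s : R) : 'M[R]_(1 + m, n) := col_mx (s *: c^T) M.
have [Q1 Q1E] := image_law_exists (measurable_mulmx (N 1)) (probability_setT P).
have [Q2 Q2E] := image_law_exists (measurable_mulmx (N (-1))) (probability_setT P).
have Q1S := centered_gaussian_mulmx PS Q1E.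
have Q2S := centered_gaussian_mulmx PS Q2E.
have cSM : c^T *m S *m M^T = 0.
  by apply: trmx_inj; rewrite !trmx_mul !trmxK PS.1.1 mulmxA MSc trmx0.
(* Since the cross term [M *m S *m c] is zero, flipping the sign of the first row leaves the matrix
   unchanged: both images are the same centered Gaussian law. *)
have NE : N (-1) *m S *m (N (-1))^T = N 1 *m S *m (N 1)^T.
  rewrite /N !tr_col_mx !mul_col_mx !mul_mx_row !linearZ /= !trmxK -!scalemxAl.
  by rewrite MSc cSM !scaler0 !scalerA mulrNN.
rewrite NE in Q2S.
pose k (w : 'cV[R]_(1 + m)) : \bar R := ((h (dsubmx w) + w (lshift m 0) 0) ^+ 2)%:E.
have mk : measurable_fun setT k.
  apply/measurable_EFinP; apply: measurable_funX; apply: measurable_funD.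
    apply: (measurableT_comp mh); apply: measurable_cV => i.
    by under eq_fun do rewrite mxE; exact: measurable_coord.
  exact: measurable_coord.
have k0 w : (0 <= k w)%E by rewrite lee_fin sqr_ge0.
have kN s x : k (N s *m x) = ((h (M *m x) + s * lin_fun c x) ^+ 2)%:E.
  rewrite /k /N mul_col_mx col_mxKd col_mxEu -scalemxAl.
  by congr ((_ + _) ^+ 2)%:E; rewrite mxE.
have I1 := ge0_integral_image_law (measurable_mulmx (N 1)) Q1E mk k0.
have I2 := ge0_integral_image_law (measurable_mulmx (N (-1))) Q2E mk k0.
have I12 : (\int[Q1]_w k w = \int[Q2]_w k w)%E.
  by apply: eq_measure_integral => A mA _; exact: eq_centered_gaussian Q1S Q2S mA.
have E1 : (\int[P]_x ((h (M *m x) + lin_fun c x) ^+ 2)%:E = \int[Q1]_w k w)%E.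
  by rewrite I1; apply: eq_integral => x _; rewrite kN mul1r.
have E2 : (\int[P]_x ((h (M *m x) - lin_fun c x) ^+ 2)%:E = \int[Q1]_w k w)%E.
  by rewrite I12 I2; apply: eq_integral => x _; rewrite kN mulN1r.
have ml := measurable_lin_fun c.
have mhM := measurableT_comp mh (measurable_mulmx M).
have m1 : measurable_fun setT (fun x => ((h (M *m x) + lin_fun c x) ^+ 2)%:E).
  by apply/measurable_EFinP; apply: measurable_funX; exact: measurable_funD.
have m2 : measurable_fun setT (fun x => ((h (M *m x) - lin_fun c x) ^+ 2)%:E).
  by apply/measurable_EFinP; apply: measurable_funX; exact: measurable_funB.
have m3 : measurable_fun setT (fun x => (lin_fun c x ^+ 2)%:E).
  by apply/measurable_EFinP; exact: measurable_funX.
have : (2%:E * \int[P]_x (lin_fun c x ^+ 2)%:E <=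
        2%:E * \int[P]_x ((h (M *m x) + lin_fun c x) ^+ 2)%:E)%E.
  have two (z : \bar R) : (2%:E * z = z + z)%E.
    by rewrite (_ : 2 = 1 + 1) // EFinD ge0_muleDl ?lee_fin // !mul1e.
  rewrite [leRHS]two [in X in (_ <= _ + X)%E]E1 -E2 -ge0_integralD //; last 2 first.
  - by move=> x _; rewrite lee_fin sqr_ge0.
  - by move=> x _; rewrite lee_fin sqr_ge0.
  rewrite -ge0_integralZl //; last by move=> x _; rewrite lee_fin sqr_ge0.
  apply: ge0_le_integral => //.
  - by move=> x _; rewrite mule_ge0 // lee_fin sqr_ge0.
  - exact: measurable_funeM.
  - exact: emeasurable_funD.
  - move=> x _; rewrite -EFinM -EFinD lee_fin.
    by have := sqr_ge0 (h (M *m x)); move: (h _) (lin_fun c x) => u v; nra.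
by rewrite lee_pmul2l // lte_fin.
Qed.

End second_moments.

(** * The estimation problem *)

Section block_vectors.
Context {R : realType}.

Lemma linear_mulmx (m n : nat) (f : 'cV[R]_n -> 'cV[R]_m) :
  (forall a x y, f (a *: x + y) = a *: f x + f y) ->
  exists M : 'M[R]_(m, n), forall x, f x = M *m x.
Proof.
move=> f_lin; exists (\matrix_(i, j) f (delta_mx j 0) i 0) => x.
have f0 : f 0 = 0.
  have := f_lin 1 0 0; rewrite !scale1r addr0 => h.
  by apply: (addrI (f 0)); rewrite addr0 -h.
have fsum (r : seq 'I_n) :
    f (\sum_(j <- r) x j 0 *: delta_mx j 0) = \sum_(j <- r) x j 0 *: f (delta_mx j 0).
  by elim: r => [|j r IH]; rewrite ?big_nil // !big_cons f_lin IH.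
have -> : f x = f (\sum_j x j 0 *: delta_mx j 0).
  by rewrite {1}[x]matrix_sum_delta; congr f; apply: eq_bigr => j _; rewrite big_ord1.
rewrite fsum; apply/matrixP => i k; rewrite !ord1 summxE mxE.
by apply: eq_bigr => j _; rewrite !mxE mulrC.
Qed.

Lemma blk_linear (k d : nat) (t : nat) a (u v : 'cV[R]_(k * d)) :
  blk (a *: u + v) t = a *: blk u t + blk v t.
Proof.
apply/matrixP => i j; rewrite !mxE; case: insub => [l|]; first by rewrite !mxE.
by rewrite mulr0 addr0.
Qed.

Lemma stk_linear (k d : nat) a (f g : nat -> 'cV[R]_d) :
  stk k d (fun t => a *: f t + g t) = a *: stk k d f + stk k d g.
Proof. by apply/matrixP => i j; rewrite !mxE. Qed.

Lemma blkE (k d : nat) (u : 'cV[R]_(k * d)) (i : 'I_(k * d)) :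
  blk u (i %/ d) (Ordinal (stk_proof i)) 0 = u i 0.
Proof. by rewrite mxE /= -divn_eq valK. Qed.

Lemma stk_blk (k d : nat) (u : 'cV[R]_(k * d)) : stk k d (blk u) = u.
Proof. by apply/matrixP => i j; rewrite mxE blkE ord1. Qed.

Lemma ltn_div_block (k d : nat) (i : 'I_(k * d)) : (i %/ d < k)%N.
Proof.
case: d i => [|d] i; last by rewrite ltn_divLR.
by have := ltn_ord i; rewrite [X in (_ < X)%N]muln0.
Qed.

Lemma eq_blk (k d t : nat) (u v : 'cV[R]_(k * d)) :
  (forall i : 'I_(k * d), (i %/ d <= t)%N -> u i 0 = v i 0) ->
  forall tau, (tau <= t)%N -> blk u tau = blk v tau.
Proof.
move=> uv tau tau_t; apply/matrixP => j l; rewrite !mxE.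
case: insubP => // i _ iE; apply: uv; rewrite iE.
by rewrite divnMDl ?divn_small ?addn0 //; apply: leq_trans (ltn_ord j).
Qed.

Lemma causal_coord (dy ds T : nat) (pi : 'cV[R]_(T * dy) -> 'cV[R]_(T * ds))
    (i : 'I_(T * ds)) (y y' : 'cV[R]_(T * dy)) : causal pi ->
  (forall j : 'I_(T * dy), (j %/ dy <= i %/ ds)%N -> y j 0 = y' j 0) ->
  pi y i 0 = pi y' i 0.
Proof.
move=> cpi yy'; rewrite -blkE -[RHS]blkE.
by rewrite (cpi _ (ltn_div_block i) y y') //; exact: eq_blk.
Qed.

Lemma block_lower_estimator (dy ds T : nat) (K : 'M[R]_(T * ds, T * dy)) :
  block_lower K -> estimators dy ds T (fun y => K *m y).
Proof.
move=> lK; split; first exact: measurable_mulmx.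
move=> t tT y y' yy'; apply/matrixP => j l; rewrite !mxE.
case: insubP => // i _ iE; rewrite !mxE; apply: eq_bigr => k _.
have it : (i %/ ds = t)%N.
  by rewrite iE divnMDl ?divn_small ?addn0 //; apply: leq_trans (ltn_ord j).
have [kt|tk] := leqP (k %/ dy) t; last by rewrite lK ?mul0r // it.
by rewrite -blkE yy' // blkE.
Qed.

End block_vectors.

Section linear_model.
Context {R : realType} {dx dw dy ds T : nat}.
Variables (A : 'M[R]_dx) (B : 'M[R]_(dx, dw)) (Cy : 'M[R]_(dy, dx)) (Cs : 'M[R]_(ds, dx)).
Local Notation Xi := 'cV[R]_(dx + T.-1 * dw + T * dy).

Lemma x_of_linear t a (u v : Xi) :
  x_of A B (a *: u + v) t = a *: x_of A B u t + x_of A B v t.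
Proof.
elim: t => [|t IH] /=; first by apply/matrixP => i j; rewrite !mxE.
have -> : w_of (a *: u + v) t = a *: w_of u t + w_of v t.
  by rewrite /w_of -blk_linear; congr blk; apply/matrixP => i j; rewrite !mxE.
by rewrite IH !mulmxDr -!scalemxAr scalerDr addrACA.
Qed.

(** The identity block is the contribution of the measurement noise; it makes [H H^T] dominate the
    identity, hence the cost coercive in the gain. *)
Lemma yvec_mulmx : exists H : 'M[R]_(T * dy, dx + T.-1 * dw + T * dy),
  rsubmx H = 1%:M /\ forall xi, yvec A B Cy xi = H *m xi.
Proof.
have v_lin t a (u v : Xi) : v_of (a *: u + v) t = a *: v_of u t + v_of v t.
  by rewrite /v_of -blk_linear; congr blk; apply/matrixP => i j; rewrite !mxE.
have [|H HE] := @linear_mulmx _ _ _ (yvec A B Cy : Xi -> _).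
  move=> a u v; rewrite /yvec -stk_linear; congr stk; apply/funext => t.
  by rewrite /y_of x_of_linear v_lin mulmxDr -scalemxAr scalerDr addrACA.
exists H; split => //.
have x0 (v : 'cV[R]_(T * dy)) t : x_of A B (col_mx 0 v : Xi) t = 0.
  have w0 : wpart (col_mx 0 v : Xi) = 0 by rewrite /wpart col_mxKu.
  elim: t => [|t IH] /=.
    by rewrite /x0_of w0; apply/matrixP => i j; rewrite !mxE.
  rewrite IH mulmx0 /w_of w0 add0r.
  have -> : blk (dsubmx (0 : 'cV[R]_(dx + T.-1 * dw))) t = 0; last by rewrite mulmx0.
  by apply/matrixP => i j; rewrite !mxE; case: insub => // l; rewrite !mxE.
have Hv (v : 'cV[R]_(T * dy)) : rsubmx H *m v = v.
  have := HE (col_mx 0 v); rewrite -{1}[H]hsubmxK mul_row_col mulmx0 add0r => <-.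
  rewrite /yvec -[RHS]stk_blk; congr stk; apply/funext => t.
  by rewrite /y_of x0 mulmx0 add0r /v_of /vpart col_mxKd.
apply/matrixP => i j; have := congr1 (fun v : 'cV[R]_(T * dy) => v i 0) (Hv (delta_mx j 0)).
by rewrite -colE !mxE eqxx andbT => ->.
Qed.

Lemma svec_mulmx : exists L : 'M[R]_(T * ds, dx + T.-1 * dw + T * dy),
  forall xi, svec A B Cs xi = L *m xi.
Proof.
apply: (@linear_mulmx _ _ _ (svec A B Cs : Xi -> _)) => a u v.
rewrite /svec -stk_linear; congr stk; apply/funext => t.
by rewrite /s_of x_of_linear mulmxDr -scalemxAr.
Qed.

End linear_model.

Lemma minimax_of_saddle {R : realType} {I J : Type} (X : set I) (Y : set J)
    (f : I -> J -> \bar R) (x : I) (y : J) :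
  X x -> Y y ->
  (forall x' y', X x' -> Y y' -> (f x y' <= f x y)%E /\ (f x y <= f x' y)%E) ->
  ereal_inf [set ereal_sup [set f x' y' | y' in Y] | x' in X] =
  ereal_sup [set ereal_inf [set f x' y' | x' in X] | y' in Y].
Proof.
move=> Xx Yy sad; apply/eqP; rewrite eq_le; apply/andP; split.
- apply: (@le_trans _ _ (f x y)).
    apply: (@le_trans _ _ (ereal_sup [set f x y' | y' in Y])).
      by apply: ereal_inf_lbound; exists x.
    by apply: ge_ereal_sup => _ [y' Yy' <-]; exact: (sad x y' Xx Yy').1.
  apply: (@le_trans _ _ (ereal_inf [set f x' y | x' in X])).
    by apply: le_ereal_inf_tmp => _ [x' Xx' <-]; exact: (sad x' y Xx' Yy).2.
  by apply: ereal_sup_ubound; exists y.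
- apply: ge_ereal_sup => _ [y' Yy' <-]; apply: le_ereal_inf_tmp => _ [x' Xx' <-].
  apply: (@le_trans _ _ (f x' y')).
    by apply: ereal_inf_lbound; exists x'.
  by apply: ereal_sup_ubound; exists y'.
Qed.

(** * The saddle point of the estimation problem *)

Section saddle_point.
Context {R : realType} {dx dw dy ds T : nat}.
Variables (A : 'M[R]_dx) (B : 'M[R]_(dx, dw)) (Cy : 'M[R]_(dy, dx)) (Cs : 'M[R]_(ds, dx)).
Local Notation N := (dx + T.-1 * dw + T * dy)%N.
Variables (H : 'M[R]_(T * dy, N)) (L : 'M[R]_(T * ds, N)).
Hypothesis HE : forall xi, yvec A B Cy xi = H *m xi.
Hypothesis LE : forall xi, svec A B Cs xi = L *m xi.

Lemma cost_mulmx (K : 'M[R]_(T * ds, T * dy)) (P : probability 'cV[R]_N R) :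
  cost A B Cy Cs (fun y => K *m y) P = (\int[P]_xi (sqnorm ((K *m H - L) *m xi))%:E)%E.
Proof.
by apply: eq_integral => xi _; rewrite /err HE LE mulmxBl mulmxA.
Qed.

Let msk (i : 'I_(T * ds)) (j : 'I_(T * dy)) := (j %/ dy <= i %/ ds)%N.

(** The cost is split into coordinates of the error because each coordinate has its own set of
    available observations, hence its own orthogonality relations. *)
Lemma gaussian_optimal_estimator (K : 'M[R]_(T * ds, T * dy)) S
    (P : probability 'cV[R]_N R) pi :
  centered_gaussian P S -> masked msk K ->
  (forall K', masked msk K' -> qf (K *m H - L) S <= qf (K' *m H - L) S) ->
  estimators dy ds T pi ->
  (cost A B Cy Cs (fun y => K *m y) P <= cost A B Cy Cs pi P)%E.
Proof.
move=> PS mK Kmin [mpi cpi]; have [pS _] := PS.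
set E := K *m H - L.
(* Normal equations: [K] is perturbed in the single admissible entry [(i, j)], and the first-order
   term must vanish. *)
have orth i j : msk i j -> (H *m S *m E^T) j i = 0.
  move=> ij; pose D : 'M[R]_(T * ds, T * dy) := delta_mx i j.
  suff : 2 * \tr (D *m (H *m S *m E^T)) = 0.
    have -> : \tr (D *m (H *m S *m E^T)) = (H *m S *m E^T) j i; last by lra.
    rewrite /mxtrace (bigD1 i) //= big1 ?addr0.
      rewrite mxE (bigD1 j) //= big1 ?addr0; first by rewrite mxE !eqxx mul1r.
      by move=> k kj; rewrite mxE (negbTE kj) andbF mul0r.
    move=> k ki; rewrite mxE big1 // => l _.
    by rewrite mxE (negbTE ki) mul0r.
  apply: (@linear_coef_eq0 _ _ (qf (D *m H) S)) => t.
  have mKD : masked msk (K + t *: D).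
    move=> k l kl; rewrite !mxE mK // add0r.
    have [/andP[/eqP ki /eqP lj]|_] := boolP ((k == i) && (l == j)); last by rewrite mulr0.
    by rewrite ki lj ij in kl.
  have := Kmin _ mKD.
  have -> : (K + t *: D) *m H - L = E + t *: (D *m H) by rewrite mulmxDl addrAC -scalemxAl.
  rewrite -/E (qfDl E _ pS.1) qfZl -!scalemxAl mxtraceZ -addrA lerDl.
  by rewrite !mulmxA; congr (0 <= _); ring.
have lE : block_lower K by move=> i j; rewrite ltnNge => /mK.
have [_ cK] := block_lower_estimator lE.
have msq p (f : 'cV[R]_N -> 'cV[R]_p) i : measurable_fun setT f ->
    measurable_fun setT (fun xi => (f xi i 0 ^+ 2)%:E).
  move=> mf; apply/measurable_EFinP; apply: measurable_funX.
  exact: (measurableT_comp (measurable_coord i) mf).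
have mE : measurable_fun setT (fun xi : 'cV[R]_N => E *m xi) by exact: measurable_mulmx.
have merr : measurable_fun setT (fun xi : 'cV[R]_N => pi (H *m xi) - L *m xi).
  apply: measurable_cV => i; under eq_fun do rewrite 2!mxE.
  apply: measurable_funB.
    exact: (measurableT_comp (measurable_coord i) (measurableT_comp mpi (measurable_mulmx H))).
  exact: (measurableT_comp (measurable_coord i) (measurable_mulmx L)).
rewrite cost_mulmx -/E.
have -> : cost A B Cy Cs pi P = (\int[P]_xi (sqnorm (pi (H *m xi) - L *m xi))%:E)%E.
  by apply: eq_integral => xi _; rewrite /err HE LE.
rewrite /sqnorm; under eq_integral do rewrite -sumEFin.
under [leRHS]eq_integral do rewrite -sumEFin.
rewrite !ge0_integral_sum //; try (by move=> i; exact: msq); try (by move=> i x _; rewrite lee_fin sqr_ge0).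
apply: lee_sum => i _.
pose c : 'cV[R]_N := (row i E)^T.
pose Dm : 'M[R]_(T * dy) := diag_mx (\row_j (msk i j)%:R).
pose h (y : 'cV[R]_(T * dy)) : R := pi y i 0 - (K *m y) i 0.
have DmE (y : 'cV[R]_(T * dy)) j : msk i j -> (Dm *m y) j 0 = y j 0.
  by move=> ij; rewrite mul_diag_mx !mxE ij mul1r.
have hD y : h (Dm *m y) = h y.
  rewrite /h; congr (_ - _); apply: causal_coord => // j ij; exact: DmE.
have cE x : lin_fun c x = (E *m x) i 0 by rewrite /lin_fun trmxK -row_mul mxE.
have HSc j : (H *m S *m c) j 0 = (H *m S *m E^T) j i.
  by rewrite /c tr_row colE mulmxA -colE mxE.
have orth_c : (Dm *m H) *m S *m c = 0.
  rewrite -mulmxA -mulmxA (mulmxA H) mul_diag_mx; apply/matrixP => j l.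
  rewrite ord1 mxE HSc mxE [RHS]mxE.
  by have [ij|_] := boolP (msk i j); [rewrite orth // mulr0|rewrite mul0r].
have mh : measurable_fun setT h.
  apply: measurable_funB.
    exact: (measurableT_comp (measurable_coord i) mpi).
  exact: (measurableT_comp (measurable_coord i) (measurable_mulmx K)).
have := gaussian_orthogonal_le PS orth_c mh; congr (_ <= _)%E.
  by apply: eq_integral => xi _; rewrite cE.
apply: eq_integral => xi _; congr (_ ^+ 2)%:E.
by rewrite -mulmxA hD cE /h mulmxBl -mulmxA !mxE; ring.
Qed.

Lemma saddle_point_exists (rho : R) (P0 : probability 'cV[R]_N R) S0 :
  0 < rho -> centered_gaussian P0 S0 -> rsubmx H = 1%:M ->
  exists (K : 'M[R]_(T * ds, T * dy)) (P : probability 'cV[R]_N R),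
    [/\ block_lower K, gaussian P, ambiguity P0 rho P,
     forall P', ambiguity P0 rho P' ->
       (cost A B Cy Cs (fun y => K *m y) P' <= cost A B Cy Cs (fun y => K *m y) P)%E
     & forall pi, estimators dy ds T pi ->
       (cost A B Cy Cs (fun y => K *m y) P <= cost A B Cy Cs pi P)%E].
Proof.
move=> rho0 P0S H1; have [pS0 _] := P0S.
have [U [UU ooU]] := free_ultrafilter.
pose SS : set 'M[R]_N := [set ulsubmx G | G in coupling_mx S0 (rho ^+ 2)].
have SS_psd S : SS S -> psd S by move=> [G [pG _ _] <-]; exact: psd_ulsubmx.
have SS_convex S S' (t : R) : 0 <= t -> t <= 1 -> SS S -> SS S' -> SS ((1 - t) *: S + t *: S').
  move=> t0 t1 [G cG <-] [G' cG' <-]; exists ((1 - t) *: G + t *: G').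
    exact: coupling_mx_convex.
  by apply/matrixP => i j; rewrite !mxE.
have SS_compact (Z : nat -> 'M[R]_N) : (forall k, SS (Z k)) -> exists S, SS S /\ mxcvg U Z S.
  move=> hZ; have hG k : exists G, coupling_mx S0 (rho ^+ 2) G /\ ulsubmx G = Z k.
    by have [G cG GZ] := hZ k; exists G.
  have [G cG] := choice hG.
  have [G' [cG' GG']] := coupling_mx_compact (fun k => (cG k).1).
  exists (ulsubmx G'); split; first by exists G'.
  move=> i j; rewrite !mxE; under eq_fun do rewrite -(cG _).2 !mxE.
  exact: GG'.
(* The noise budget: isotropic noise of variance [d] costs [d * N], which fits in the ball; the
   [+ 1] keeps the quotient meaningful for [N = 0]. *)
pose d : R := rho ^+ 2 / (N%:R + 1).
have d0 : 0 < d by rewrite divr_gt0 ?exprn_gt0 // ltr_wpDl.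
have dN : d * N%:R <= rho ^+ 2.
  by rewrite /d mulrAC ler_pdivrMr ?ltr_wpDl // ler_wpM2l ?sqr_ge0 // lerDl.
have SS1 : SS (S0 + d%:M).
  exists (block_mx (S0 + d%:M) S0 S0 S0); last by rewrite block_mxKul.
  by apply: coupling_mx_shift => //; exact: ltW.
have coer (K : 'M[R]_(T * ds, T * dy)) : d * qf K 1%:M <= qf (K *m H) (S0 + d%:M).
  have -> : S0 + d%:M = 1 *: S0 + d *: 1%:M by rewrite scale1r scalemx1.
  have HHT : H *m H^T = 1 *: (lsubmx H *m (lsubmx H)^T) + 1 *: 1%:M.
    by rewrite -{1 2}[H]hsubmxK tr_row_mx mul_row_col H1 trmx1 mulmx1 !scale1r.
  have h1 : 0 <= qf (K *m H) S0 by exact: qf_ge0.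
  have h2 : qf K 1%:M <= qf (K *m H) 1%:M.
    rewrite qf_mull mulmx1 HHT qfDr !mul1r lerDr.
    have := psd_conj (lsubmx H) (psd1 _); rewrite mulmx1 => pLL.
    exact: qf_ge0.
  rewrite qfDr mul1r.
  have h3 : d * qf K 1%:M <= d * qf (K *m H) 1%:M by rewrite ler_pM2l.
  lra.
have [K [S [mK SSS maxS minK]]] :=
  masked_saddle ooU L msk SS_psd SS_convex SS_compact SS1 d0 coer.
have [G cG GS] := SSS.
have [P [PS W2P]] := coupling_mx_gaussian P0S cG; rewrite GS in PS.
exists K, P; split.
- by move=> i j; rewrite ltnNge => /mK.
- exact: centered_gaussianW PS.
- split; last by rewrite W2_le // ltW.
  rewrite /second_moment_finite; under eq_integral do rewrite -[X in sqnorm X]mul1mx.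
  by rewrite (centered_gaussian_sqnorm _ PS) ltry.
- move=> P' ambP'; rewrite !cost_mulmx (centered_gaussian_sqnorm _ PS).
  apply: (ambiguity_bound rho0 P0S _ ambP') => G' cG'; apply: maxS; by exists G'.
- by move=> pi; exact: (gaussian_optimal_estimator PS mK minK).
Qed.

End saddle_point.

Unset Implicit Arguments.

Theorem theorem3p1 (R : realType) (dx dw dy ds T : nat)
  (A : 'M[R]_dx) (B : 'M[R]_(dx, dw)) (Cy : 'M[R]_(dy, dx)) (Cs : 'M[R]_(ds, dx))
  (hdetY : detectable A Cy) (hdetS : detectable A Cs) (hctrb : controllable A B)
  (hT : (0 < T)%N) (rho : R) (hrho : 0 < rho)
  (P0 : probability 'cV[R]_(dx + T.-1 * dw + T * dy) R)
  (hP0 : gaussian_with_mean 0 P0) :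
  (* minimax equality *)
  ereal_inf [set ereal_sup [set cost A B Cy Cs pi P | P in ambiguity P0 rho]
            | pi in estimators dy ds T]
  = ereal_sup [set ereal_inf [set cost A B Cy Cs pi P | pi in estimators dy ds T]
              | P in ambiguity P0 rho]
  /\
  (* saddle point (K y, Pstar): linear causal estimator, Gaussian distribution *)
  (exists (K : 'M[R]_(T * ds, T * dy)) (Pstar : probability 'cV[R]_(dx + T.-1 * dw + T * dy) R),
    block_lower K /\ gaussian Pstar /\
    estimators dy ds T (fun y => K *m y) /\ ambiguity P0 rho Pstar /\
    (forall pi P, estimators dy ds T pi -> ambiguity P0 rho P ->
       (cost A B Cy Cs (fun y => K *m y) P <= cost A B Cy Cs (fun y => K *m y) Pstar)%E /\
       (cost A B Cy Cs (fun y => K *m y) Pstar <= cost A B Cy Cs pi Pstar)%E)).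
Proof.
have [H [H1 HE]] := @yvec_mulmx R dx dw dy T A B Cy.
have [L LE] := @svec_mulmx R dx dw dy ds T A B Cs.
have [S0 P0S] := gaussian_with_mean0 hP0.
have [K [P [lK gP ambP supP infK]]] := saddle_point_exists HE LE hrho P0S H1.
have estK := block_lower_estimator lK.
have saddle pi P' : estimators dy ds T pi -> ambiguity P0 rho P' ->
    (cost A B Cy Cs (fun y => K *m y) P' <= cost A B Cy Cs (fun y => K *m y) P)%E /\
    (cost A B Cy Cs (fun y => K *m y) P <= cost A B Cy Cs pi P)%E.
  by move=> estpi ambP'; split; [exact: supP|exact: infK].
split; last by exists K, P.
exact: (minimax_of_saddle (f := cost A B Cy Cs) estK ambP saddle).
Qed.
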